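(* Let $G$ be a countable group. For every sequence $(a_n)_n\subset\overline{\mathrm{Act}}(G)$ and every non-principal ultrafilter $\mathfrak{u}$ on $\mathbf{N}$, the limit of $(a_n)_n$ along $\mathfrak{u}$ in the WC-topology exists and is (the class of actions) weakly equivalent to the ultraproduct action $a_{\mathfrak{u}}$. In particular, a sequence $(a_n)_n$ converges to $a$ in the WC-topology if and only if $a$ is weakly equivalent to the ultraproduct action $a_{\mathfrak{u}}$ of $(a_n)_n$ with respect to every non-principal ultrafilter $\mathfrak{u}$.
   Context: A pmp action $a$ of $G$ is an action by measure preserving automorphisms of a probability space $(\mathfrak{X}_a,\mu_a)$, not assumed standard. $\mathrm{Part}_k(\mathfrak{X})$ is the set of ordered measurable partitions of $\mathfrak{X}$ into $k$ pieces (null pieces allowed). For finite $F\subset G$, $\alpha=\{A_1,\ldots,A_k\}\in\mathrm{Part}_k(\mathfrak{X}_a)$, and pmp actions $a,b$, set $$\mathrm{d}_{F,\alpha}(a,b)=\inf_{\{B_1,\ldots,B_k\}\in\mathrm{Part}_k(\mathfrak{X}_b)}\sum_{i,j\leq k}\sum_{f\in F}|\mu_a(A_i\cap fA_j)-\mu_b(B_i\cap fB_j)|,\qquad \mathrm{d}_{F,k}(a,b)=\sup_{\alpha\in\mathrm{Part}_k(\mathfrak{X}_a)}\mathrm{d}_{F,\alpha}(a,b).$$ Then $a\prec b$ ($a$ is weakly contained in $b$) means $\mathrm{d}_{F,k}(a,b)=0$ for all finite $F\subset G$ and $k\in\mathbf{N}$; $a$ and $b$ are weakly equivalent if $a\prec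 b$ and $b\prec a$. $\mathrm{Act}(G)$ is the set of pmp actions of $G$ on a fixed standard diffuse probability space together with the actions of $G$ on the finite sets $\{1,\ldots,n\}$, $n\in\mathbf{N}$, with normalized counting measure. $\overline{\mathrm{Act}}(G)$ is the set of weak equivalence classes of elements of $\mathrm{Act}(G)$. Every pmp action on a diffuse (atomless) probability space, possibly non-standard, is weakly equivalent to one in $\mathrm{Act}(G)$, so $\overline{\mathrm{Act}}(G)$ is identified with the set of weak equivalence classes of pmp actions of $G$ on arbitrary diffuse or finite uniform probability spaces. The WC-topology on $\overline{\mathrm{Act}}(G)$ is the topology generated by the pseudo-metrics $\overline{\mathrm{d}}_{F,k}(a,b)=\mathrm{d}_{F,k}(a,b)+\mathrm{d}_{F,k}(b,a)$, $F\subset G$ finite, $k\in\mathbf{N}$. Ultraproducts: given a non-principal ultrafilter $\mathfrak{u}$ on $\mathbf{N}$ and probability spaces $(\mathfrak{X}_n,\mathscr{B}_n,\mu_n)$, let $\mathfrak{X}_{\mathfrak{u}}=\prod_n\mathfrak{X}_n/\sim$, where $(x_n)\sim(y_n)$ iff $\{n:x_n=y_n\}\in\mathfrak{u}$; write $[x_n]_{\mathfrak{u}}$ for the class of $(x_n)_n$ and $[A_n]_{\mathfrak{u}}$ for the image of $\prod_n A_n$. Let $\theta(A)=\inf\{\sum_{i\in\mathbf{N}}\lim_{n\in\mathfrak{u}}\mu_n(B^i_n): A\subset\bigcup_i[B^i_n]_{\mathfrak{u}},\ B^i_n\in\mathscr{B}_n\}$; the ultraproduct $(\mathfrak{X}_{\mathfrak{u}},\mathscr{B}_{\mathfrak{u}},\mu_{\mathfrak{u}})$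 is the probability space obtained from the outer measure $\theta$ by Carathéodory's construction. The ultraproduct $a_{\mathfrak{u}}$ of a sequence $(a_n)_n$ of pmp actions is the action of $G$ on the ultraproduct of the spaces $(\mathfrak{X}_{a_n},\mu_{a_n})$ given by $g[x_n]_{\mathfrak{u}}=[gx_n]_{\mathfrak{u}}$ (for classes, choose representatives). *)

(* Defs.v *)
From HB Require Import structures.
From mathcomp Require Import all_boot all_order all_algebra finmap.
From mathcomp Require Import generic_quotient.
From mathcomp Require Import all_classical all_reals all_analysis.

Set Implicit Arguments.
Unset Strict Implicit.
Unset Printing Implicit Defensive.
Import Order.TTheory GRing.Theory Num.Theory.
Import numFieldNormedType.Exports.

Local Open Scope classical_set_scope.
Local Open Scope ring_scope.

(* The action is by everywhere defined measurable maps; since inverses act as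
   well, each of them is an automorphism of the measure space. *)
Record pmp_on (G : groupType) (R : realType) (d : measure_display)
    (X : measurableType d) (mu : probability X R) := PmpOn {
  act_fun : G -> X -> X ;
  act_fun1 : forall x, act_fun 1%g x = x ;
  act_funM : forall g h x, act_fun (g * h)%g x = act_fun g (act_fun h x) ;
  measurable_act_fun : forall g, measurable_fun setT (act_fun g) ;
  act_fun_preserving : forall g A, measurable A ->
    mu (act_fun g @^-1` A) = mu A }.

Record pmp_action (G : groupType) (R : realType) := PmpAction {
  pmp_disp : measure_display ;
  pmp_space : measurableType pmp_disp ;
  pmp_prob : probability pmp_space R ;
  pmp_act_on : pmp_on G pmp_prob }.

Definition act (G : groupType) (R : realType) (a : pmp_action G R) :
  G -> pmp_space a -> pmp_space a := act_fun (pmp_act_on a).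

Section weak_containment.
Context {G : groupType} {R : realType}.
Implicit Types (a b c : pmp_action G R) (F : {fset G}) (k : nat).

Local Notation pieces k a := ('I_k -> set (pmp_space a)).

(* The set Part_k of ordered measurable partitions; pieces may be empty. *)
Definition Part k a : set (pieces k a) :=
  [set A | [/\ forall i, measurable (A i), trivIset setT A &
               \bigcup_i A i = setT]].
Arguments Part k a _ : clear implicits.

Definition part_stat k a (A : pieces k a) (f : G)
    (i j : 'I_k) : R :=
  fine (pmp_prob a (A i `&` act f @` A j)).

Definition part_dist F k a b (A : pieces k a)
    (B : pieces k b) : R :=
  \sum_(i < k) \sum_(j < k) \sum_(f <- F)
    `| part_stat A f i j - part_stat B f i j |.

Definition dpart F k a b (A : pieces k a) : R :=
  inf [set part_dist F A B | B in Part k b].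

Definition dweak F k a b : R := sup [set dpart F b A | A in Part k a].

Definition weakly_contained a b := forall F k, dweak F k a b = 0.

Definition weakly_equivalent a b :=
  weakly_contained a b /\ weakly_contained b a.

Lemma part_stat_ge0 k a (A : pieces k a) f i j : 0 <= part_stat A f i j.
Proof. exact/fine_ge0/measure_ge0. Qed.

Lemma act_image a (g : G) (A : set (pmp_space a)) :
  act g @` A = act (g^-1)%g @^-1` A.
Proof.
rewrite /act; apply/seteqP; split => [_ [x Ax <-]|x /= Ax].
  by rewrite /= -act_funM mulVg act_fun1.
exists (act_fun (pmp_act_on a) (g^-1)%g x) => //.
by rewrite -act_funM mulgV act_fun1.
Qed.

Lemma part_stat_le1 k a (A : pieces k a) f i j :
  Part k a A -> part_stat A f i j <= 1.
Proof.
move=> [mA _ _]; rewrite /part_stat -lee_fin fineK.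
  apply: probability_le1; apply: measurableI => //.
  rewrite act_image -[X in measurable X]setTI.
  exact: (measurable_act_fun (pmp_act_on a)).
apply: fin_num_measure; apply: measurableI => //.
rewrite act_image -[X in measurable X]setTI.
exact: (measurable_act_fun (pmp_act_on a)).
Qed.

Lemma part_dist_ge0 F k a b (A : pieces k a) (B : pieces k b) :
  0 <= part_dist F A B.
Proof. by do 3! (apply: sumr_ge0 => ? _). Qed.

Lemma part_dist_refl F k a (A : pieces k a) : part_dist F A A = 0.
Proof.
rewrite /part_dist big1// => i _; rewrite big1// => j _.
by rewrite big1// => f _; rewrite subrr normr0.
Qed.

Lemma part_dist_triangle F k a b c (A : pieces k a) (B : pieces k b)
    (C : pieces k c) :
  part_dist F A C <= part_dist F A B + part_dist F B C.
Proof.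
rewrite /part_dist -big_split; apply: ler_sum => i _ /=.
rewrite -big_split; apply: ler_sum => j _ /=.
by rewrite -big_split; apply: ler_sum => f _ /=; exact: ler_distD.
Qed.

Definition part_bound F k : R := \sum_(i < k) \sum_(j < k) \sum_(f <- F) 1.

Lemma part_dist_bound F k a b (A : pieces k a) (B : pieces k b) :
  Part k a A -> Part k b B ->
  part_dist F A B <= part_bound F k.
Proof.
move=> pA pB; apply: ler_sum => i _; apply: ler_sum => j _.
apply: ler_sum => f _; have := part_stat_le1 f i j pA.
have := part_stat_le1 f i j pB; have := part_stat_ge0 A f i j.
have := part_stat_ge0 B f i j; move=> h1 h2 h3 h4.
rewrite ler_norml; apply/andP; split.
  by rewrite lerBrDl (le_trans _ h2)// subr_le0.
by rewrite lerBlDr (le_trans h4)// lerDl.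
Qed.

Lemma Part_nonempty k a b : Part k a !=set0 -> Part k b !=set0.
Proof.
case: k => [|k] [A [_ _ cA]].
  have : [set: pmp_space a] point by [].
  by rewrite -cA => -[[]].
exists (fun i => if i == ord0 then setT else set0); split.
- by move=> i; case: ifP.
- apply/trivIsetP => i j _ _ ij.
  case: (eqVneq i ord0) ij => [->|_ _]; last by rewrite set0I.
  by rewrite eq_sym => /negbTE ->; rewrite setI0.
- by apply/seteqP; split => // x _; exists ord0.
Qed.

Lemma dpart_le F k a b (A : pieces k a) (B : pieces k b) : Part k b B ->
  dpart F b A <= part_dist F A B.
Proof.
move=> pB; apply: ge_inf; last by exists B.
by exists 0 => _ [? _ <-]; exact: part_dist_ge0.
Qed.

Lemma dpart_ge0 F k a b (A : pieces k a) : 0 <= dpart F b A.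
Proof.
rewrite /dpart.
have [->|/set0P E0] := eqVneq [set part_dist F A B | B in Part k b] set0.
  by rewrite inf0.
by apply: lb_le_inf => // _ [? _ <-]; exact: part_dist_ge0.
Qed.

Lemma dpart_adherent F k a b A (e : R) : Part k a A -> 0 < e ->
  exists2 B, Part k b B & part_dist F A B < dpart F b A + e.
Proof.
move=> pA e0.
have [B0 pB0] : Part k b !=set0 by apply: Part_nonempty; exists A; exact: pA.
have hi : has_inf [set part_dist F A B | B in Part k b].
  split; first by exists (part_dist F A B0); exists B0.
  by exists 0 => _ [? _ <-]; exact: part_dist_ge0.
by have [_ [B pB <-] ltB] := inf_adherent e0 hi; exists B.
Qed.

Lemma dweak_ub F k a b (A : pieces k a) :
  Part k a A -> dpart F b A <= dweak F k a b.
Proof.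
move=> pA; apply: ub_le_sup; last by exists A.
have [B0 pB0] : Part k b !=set0 by apply: Part_nonempty; exists A; exact: pA.
exists (part_bound F k) => _ [C pC <-].
by apply: le_trans (dpart_le _ _ pB0) _; exact: part_dist_bound.
Qed.

Lemma dweak_lub F k a b (r : R) : 0 <= r ->
  (forall A, Part k a A -> dpart F b A <= r) -> dweak F k a b <= r.
Proof.
move=> r0 hr; rewrite /dweak.
have [->|/set0P E0] := eqVneq [set dpart F b A | A in Part k a] set0.
  by rewrite sup0.
by apply: ge_sup => // _ [A pA <-]; exact: hr.
Qed.

Lemma dweak_ge0 F k a b : 0 <= dweak F k a b.
Proof.
rewrite /dweak; have [->|/set0P [_ [A pA _]]] :=
  eqVneq [set dpart F b A | A in Part k a] set0; first by rewrite sup0.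
exact: le_trans (dpart_ge0 F b A) (dweak_ub F b pA).
Qed.

Lemma dweak_triangle F k a b c :
  dweak F k a c <= dweak F k a b + dweak F k b c.
Proof.
apply: dweak_lub; first by rewrite addr_ge0 ?dweak_ge0.
move=> A pA; apply/ler_addgt0Pr => e e0.
have e20 : 0 < e / 2 by rewrite divr_gt0.
have [B pB ltB] := dpart_adherent F b pA e20.
have [C pC ltC] := dpart_adherent F c pB e20.
apply: le_trans (dpart_le _ _ pC) _.
apply: le_trans (part_dist_triangle _ _ B _) _.
rewrite [e]splitr addrACA; apply: lerD.
  by apply: le_trans (ltW ltB) _; rewrite lerD2r dweak_ub.
by apply: le_trans (ltW ltC) _; rewrite lerD2r dweak_ub.
Qed.

Lemma dweak_refl F k a : dweak F k a a = 0.
Proof.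
apply/eqP; rewrite eq_le dweak_ge0 andbT; apply: dweak_lub => // A pA.
by rewrite -(part_dist_refl F A); exact: dpart_le.
Qed.

Lemma weakly_contained_trans a b c :
  weakly_contained a b -> weakly_contained b c -> weakly_contained a c.
Proof.
move=> ab bc F k; apply/eqP; rewrite eq_le dweak_ge0 andbT.
by rewrite (le_trans (dweak_triangle _ _ _ b _))// ab bc addr0.
Qed.

End weak_containment.
Arguments Part {G R} k a _.

Definition fin_space (n : nat) : Type := 'I_n.+1.
HB.instance Definition _ n := Choice.on (fin_space n).
HB.instance Definition _ n := isPointed.Build (fin_space n) ord0.
HB.instance Definition _ n := @isMeasurable.Build default_measure_display
  (fin_space n) discrete_measurable discrete_measurable0
  discrete_measurableC discrete_measurableU.

(* [counting] has finite nonzero total mass here, so that [mnormalize] never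
   uses its default value, the Dirac mass. *)
Definition fin_prob (R : realType) (n : nat) : probability (fin_space n) R :=
  mnormalize (counting : {measure set (fin_space n) -> \bar R})
    (\d_(point : fin_space n)).

(* The fixed standard diffuse space: the Borel real line with the uniform
   distribution on [0, 1]. *)
Definition std_prob (R : realType) : probability (measurableTypeR R) R :=
  uniform_prob (@ltr01 R).

(* [FinAct n] is an action on a set with [n.+1] elements. *)
Inductive Act (G : groupType) (R : realType) :=
| StdAct of pmp_on G (std_prob R)
| FinAct (n : nat) of pmp_on G (fin_prob R n).

Definition action_of (G : groupType) (R : realType) (a : Act G R) :
    pmp_action G R :=
  match a with
  | StdAct s => PmpAction s
  | FinAct n s => PmpAction s
  end.
Coercion action_of : Act >-> pmp_action.

Section weak_classes.
Context (G : groupType) (R : realType).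

HB.instance Definition _ := gen_eqMixin (Act G R).
HB.instance Definition _ := gen_choiceMixin (Act G R).

Definition weq (a b : Act G R) : bool := `[< weakly_equivalent a b >].

Lemma weq_refl : reflexive weq.
Proof. by move=> a; apply/asboolP; split=> F k; exact: dweak_refl. Qed.

Lemma weq_sym : symmetric weq.
Proof. by move=> a b; apply/asboolP/asboolP => -[]. Qed.

Lemma weq_trans : transitive weq.
Proof.
move=> b a c /asboolP[ab ba] /asboolP[bc cb]; apply/asboolP.
by split; apply: (weakly_contained_trans (b := b)).
Qed.

Canonical weq_equiv := EquivRel weq weq_refl weq_sym weq_trans.

Definition ActBar := {eq_quot weq_equiv}%qT.
HB.instance Definition _ := Choice.on ActBar.
HB.instance Definition _ := EqQuotient.on ActBar.

Definition wclass (a : Act G R) : ActBar := (\pi_ActBar a)%qT.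

(* [repr] picks a member of the class; by [dbar_wclass] the choice of
   representatives is irrelevant. *)
Definition dbar (F : {fset G}) (k : nat) (x y : ActBar) : R :=
  dweak F k (repr x) (repr y) + dweak F k (repr y) (repr x).

Lemma weq_repr (a : Act G R) : weakly_equivalent (repr (wclass a)) a.
Proof. by apply/asboolP; have /eqmodP := reprK (wclass a). Qed.

Lemma dweak_weq (F : {fset G}) (k : nat) (a a' b b' : pmp_action G R) :
  weakly_equivalent a a' -> weakly_equivalent b b' ->
  dweak F k a b = dweak F k a' b'.
Proof.
move=> [aa' a'a] [bb' b'b]; apply/eqP; rewrite eq_le; apply/andP; split.
- rewrite (le_trans (dweak_triangle _ _ _ a' _))// aa' add0r.
  by rewrite (le_trans (dweak_triangle _ _ _ b' _))// b'b addr0.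
- rewrite (le_trans (dweak_triangle _ _ _ a _))// a'a add0r.
  by rewrite (le_trans (dweak_triangle _ _ _ b _))// bb' addr0.
Qed.

Lemma dbar_wclass (F : {fset G}) (k : nat) (a b : Act G R) :
  dbar F k (wclass a) (wclass b) = dweak F k a b + dweak F k b a.
Proof.
by rewrite /dbar; congr (_ + _); apply: dweak_weq; exact: weq_repr.
Qed.

Definition class_equivalent (x : ActBar) (b : pmp_action G R) : Prop :=
  weakly_equivalent (repr x) b.

Lemma class_equivalent_wclass (a : Act G R) (b : pmp_action G R) :
  class_equivalent (wclass a) b <-> weakly_equivalent a b.
Proof.
have [ra ar] := weq_repr a.
by split=> -[h1 h2]; split;
  [exact: weakly_contained_trans ar h1|exact: weakly_contained_trans h2 ra
  |exact: weakly_contained_trans ra h1|exact: weakly_contained_trans h2 ar].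
Qed.

(* The WC-topology: the open balls of the pseudo-metrics [dbar F k] form a
   subbase. *)
Definition wc_ball (B : set ActBar) : Prop :=
  exists F k x (e : R), 0 < e /\ B = [set y | dbar F k x y < e].

HB.instance Definition _ := isSubBaseTopological.Build ActBar wc_ball id.

End weak_classes.

Record nonprincipal_ultrafilter := NonprincipalUltrafilter {
  ultra_sets : set_system nat ;
  ultra_sets_ultra : UltraFilter ultra_sets ;
  ultra_sets_nonprincipal : forall n, ultra_sets <> principal_filter n }.
#[global] Existing Instance ultra_sets_ultra.

Lemma ultra_setC1 (U : nonprincipal_ultrafilter) (m : nat) :
  ultra_sets U (~` [set m]).
Proof.
have [Um|//] := in_ultra_setVsetC [set m] (ultra_sets_ultra U).
case: (@ultra_sets_nonprincipal U m).
have [_ /(_ (ultra_sets U))] := principal_filter_ultra m; apply.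
by move=> A /principal_filterP Am; apply: filterS Um => _ ->.
Qed.

Lemma ultra_ge (U : nonprincipal_ultrafilter) (m : nat) :
  ultra_sets U [set n | (m <= n)%N].
Proof.
elim: m => [|m ih]; first exact: filterE.
apply: filterS2 ih (ultra_setC1 U m) => n /= mn /eqP nm.
by rewrite ltn_neqAle mn eq_sym nm.
Qed.

Section ultraproduct_space.
Context (R : realType) (U : nonprincipal_ultrafilter).
Context (d : nat -> measure_display) (T : forall n, measurableType (d n)).
Context (mu : forall n, probability (T n) R).

Definition useq : Type := forall n, T n.
HB.instance Definition _ := gen_eqMixin useq.
HB.instance Definition _ := gen_choiceMixin useq.

Definition ueq (x y : useq) : bool := `[< ultra_sets U [set n | x n = y n] >].

Lemma ueq_refl : reflexive ueq.
Proof. by move=> x; apply/asboolP; apply: filterE. Qed.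

Lemma ueq_sym : symmetric ueq.
Proof.
by move=> x y; apply/asboolP/asboolP; apply: filterS => n /=.
Qed.

Lemma ueq_trans : transitive ueq.
Proof.
move=> y x z /asboolP xy /asboolP yz; apply/asboolP.
by apply: filterS2 xy yz => n /= ->.
Qed.

Canonical ueq_equiv := EquivRel ueq ueq_refl ueq_sym ueq_trans.

Definition uprod := {eq_quot ueq_equiv}%qT.
HB.instance Definition _ := Choice.on uprod.
HB.instance Definition _ := EqQuotient.on uprod.

Definition ucls (x : useq) : uprod := (\pi_uprod x)%qT.

HB.instance Definition _ := isPointed.Build uprod (ucls (fun=> point)).

Definition internal (A : forall n, set (T n)) : set uprod :=
  ucls @` [set x | forall n, A n (x n)].

Definition ulim (A : forall n, set (T n)) : \bar R :=
  lim (mu n (A n) @[n --> ultra_sets U]).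

Definition internal_cover (A : set uprod) :
    set (nat -> forall n, set (T n)) :=
  [set B | (forall i n, measurable (B i n)) /\
           A `<=` \bigcup_i internal (B i)].

Definition theta (A : set uprod) : \bar R :=
  ereal_inf [set (\sum_(i <oo) ulim (B i))%E | B in internal_cover A].


Lemma uclsP (x y : useq) : (ucls x = ucls y) <->
  ultra_sets U [set n | x n = y n].
Proof.
split=> [/eqmodP /asboolP //|h].
by apply/eqmodP/asboolP.
Qed.

Lemma ucls_repr (x : uprod) : ucls (repr x) = x.
Proof. exact: reprK. Qed.

Lemma internal_sub (A : forall n, set (T n)) (x : useq) :
  internal A (ucls x) ->
  ultra_sets U [set n | A n (x n)].
Proof. by move=> [y /= Ay /uclsP]; apply: filterS => n /= <-. Qed.

Local Notation measurable_seq A := (forall n, measurable (A n)) (only parsing).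

Lemma ulim_ex (A : forall n, set (T n)) : measurable_seq A ->
  exists2 l : R, 0 <= l <= 1 & mu n (A n) @[n --> ultra_sets U] --> l%:E.
Proof.
move=> mA; pose f n : R := fine (mu n (A n)).
have f01 n : `[(0 : R), 1]%classic (f n).
  rewrite /= in_itv /= -!lee_fin fineK ?fin_num_measure//.
  by rewrite measure_ge0 probability_le1.
have cpt := @segment_compact R 0 1.
have [l [l01 cl]] :=
  cpt (f @ ultra_sets U) _ (@filterE _ (ultra_sets U) _ _ f01).
exists l; first by move: l01; rewrite /= in_itv.
apply: cvg_EFin; first by apply: filterE => n; rewrite fin_num_measure.
move=> V Vl.
have [//|CV] := in_ultra_setVsetC (f @^-1` V) (ultra_sets_ultra U).
by have [z []] := cl (~` V) V CV Vl.
Qed.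

Lemma ulim_cvg (A : forall n, set (T n)) : measurable_seq A ->
  mu n (A n) @[n --> ultra_sets U] --> ulim A.
Proof. by move=> /ulim_ex[l _ Al]; rewrite /ulim (cvg_lim _ Al). Qed.

Lemma ulim_fin (A : forall n, set (T n)) : measurable_seq A ->
  ulim A \is a fin_num.
Proof. by move=> /ulim_ex[l _ Al]; rewrite /ulim (cvg_lim _ Al). Qed.

Lemma ulim_ge0 (A : forall n, set (T n)) : measurable_seq A ->
  (0 <= ulim A)%E.
Proof.
by move=> /ulim_ex[l /andP[l0 _] Al]; rewrite /ulim (cvg_lim _ Al)// lee_fin.
Qed.

Lemma ulim_cst (A : forall n, set (T n)) (r : \bar R) :
  (forall n, mu n (A n) = r) -> ulim A = r.
Proof.
move=> Ar; apply: cvg_lim => //; rewrite (_ : (fun n => _) = fun=> r).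
  exact: cvg_cst.
exact/funext.
Qed.

Lemma le_theta : {homo theta : A B / A `<=` B >-> (A <= B)%E}.
Proof.
move=> A B AB; apply/ereal_inf_le_tmp => x [C [mC BC]] <-{x}.
by exists C => //; split => //; apply: subset_trans AB BC.
Qed.

Lemma theta_ge0 A : (0 <= theta A)%E.
Proof.
apply: le_ereal_inf_tmp => x [B [mB AB] <-{x}].
by apply: nneseries_ge0 => n _ _; exact: ulim_ge0.
Qed.

Lemma theta_le_ulim (B : forall n, set (T n)) (A : set uprod) :
  measurable_seq B -> A `<=` internal B -> (theta A <= ulim B)%E.
Proof.
move=> mB AB; apply: ereal_inf_lbound.
exists (fun i => if i is 0%N then B else fun n => set0).
  split; first by move=> [|i] n.
  by move=> x /AB Bx; exists 0%N.
rewrite nneseries_recl//; last first.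
  by move=> [|i] _; apply: ulim_ge0.
rewrite eseries_cond eseries0 ?adde0// => -[|i]//= _ _.
by apply: ulim_cst => n; rewrite measure0.
Qed.

Lemma theta0 : theta set0 = 0%E.
Proof.
apply/eqP; rewrite eq_le theta_ge0 andbT.
rewrite (le_trans (@theta_le_ulim (fun=> set0) _ _ _))//.
by rewrite (@ulim_cst _ 0%E).
Qed.

Lemma theta_sigma_subadditive : sigma_subadditive theta.
Proof.
move=> A; have [[i ioo]|] := pselect (exists i, theta (A i) = +oo%E).
  rewrite (eseries_pinfty _ _ ioo) ?leey// => n _.
  by rewrite -ltNye (lt_le_trans _ (theta_ge0 _)).
rewrite -forallNE => Aoo.
suff add2e (e : {posnum R}) :
    (theta (\bigcup_n A n) <= \sum_(i <oo) theta (A i) + e%:num%:E)%E.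
  by apply/lee_addgt0Pr => _/posnumP[].
rewrite (le_trans _ (epsilon_trick _ _ _))//; last first.
  by move=> n; exact: theta_ge0.
pose P n B := internal_cover (A n) B /\
  (\sum_(k <oo) ulim (B k) <= theta (A n) + (e%:num / (2 ^ n.+1)%:R)%:E)%E.
have [G PG] : {G : nat -> nat -> forall n, set (T n) & forall n, P n (G n)}.
  apply: (@choice _ _ P) => n; rewrite /P /theta.
  set S := (X in ereal_inf X); move infS : (ereal_inf S) => iS.
  case: iS infS => [r Sr|Soo|Soo].
  - have en1 : (0 < e%:num / (2 ^ n.+1)%:R)%R by [].
    have /(lb_ereal_inf_adherent en1) : ereal_inf S \is a fin_num by rewrite Sr.
    move=> [x [B [mB AnB] muBx] xS].
    by exists B; split => //; rewrite muBx -Sr; exact/ltW.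
  - by have := Aoo n; rewrite /theta Soo.
  - suff : lbound S 0 by move/le_ereal_inf_tmp; rewrite Soo.
    move=> /= _ [B [mB AnB] <-]; apply: nneseries_ge0 => ? _ _; exact: ulim_ge0.
pose nu := fun p : nat * nat => ulim (G p.1 p.2).
have nu_ge0 x : (0 <= nu x)%E by apply: ulim_ge0; exact: (PG x.1).1.1.
apply: (@le_trans _ _ (\esum_(i in setT) nu i)).
  apply: ereal_inf_lbound => /=.
  have /card_esym/ppcard_eqP[f] := card_nat2.
  exists (fun k => G (f k).1 (f k).2).
    split => [i n|]; first exact: (PG (f i).1).1.1.
    move=> t [i _ /(PG i).1.2 [j _ Bijt]].
    by exists (f^-1%FUN (i, j)) => //=; rewrite invK ?inE.
  rewrite -(esum_pred_image nu _ xpredT) ?[fun=> _]set_true//.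
  by rewrite image_eq.
rewrite (_ : esum _ _ = (\sum_(i <oo) \sum_(j <oo) ulim (G i j))%E); last first.
  pose J : nat -> set (nat * nat) := fun i => [set (i, j) | j in setT].
  rewrite (_ : setT = \bigcup_k J k); last first.
    by rewrite predeqE => -[a b]; split => // _; exists a => //; exists b.
  rewrite esum_bigcupT /=; last 2 first.
    - apply/trivIsetP => i j _ _ ij.
      rewrite predeqE => -[n m] /=; split => //= -[] [_] _ [<-{n} _].
      by move=> [m' _] [] /esym/eqP; rewrite (negbTE ij).
    - by move=> /= [n m]; exact: nu_ge0.
  rewrite -(image_id [set: nat]) -fun_true esum_pred_image//; last first.
    by move=> n _; apply: esum_ge0 => ? _; exact: nu_ge0.
  apply: eq_eseriesr => /= j _.
  rewrite -(esum_pred_image nu (pair j) predT)//=; last first.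
    by move=> ? ? _ _; exact: (@can_inj _ _ _ snd).
  by congr esum; rewrite predeqE => -[a b]; split; move=> [i _ <-]; exists i.
apply: lee_lim.
- apply: is_cvg_nneseries => n *.
  by apply: nneseries_ge0 => m *; exact: (nu_ge0 (n, m)).
- by apply: is_cvg_nneseries => n *; apply: adde_ge0 => //; exact: theta_ge0.
- by near=> n; apply: lee_sum => i _; exact: (PG i).2.
Unshelve. all: by end_near. Qed.

HB.instance Definition _ := isOuterMeasure.Build R uprod theta
  theta0 theta_ge0 le_theta theta_sigma_subadditive.

(* Countable saturation: countably many internal sets covering the whole space
   have total measure at least 1. *)
Lemma theta_setT : theta setT = 1%E.
Proof.
apply/eqP; rewrite eq_le; apply/andP; split.
  rewrite (le_trans (@theta_le_ulim (fun=> setT) _ _ _))//.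
    by move=> x _; rewrite -(ucls_repr x); exists (repr x).
  by rewrite (@ulim_cst _ 1%E)// => n; exact: probability_setT.
apply: le_ereal_inf_tmp => _ [B [mB covB] <-].
rewrite leNgt; apply/negP => lt1.
have sum_lt1 N : (\sum_(i < N) ulim (B i) < 1)%E.
  apply: le_lt_trans lt1; rewrite -(big_mkord xpredT (fun i => ulim (B i))).
  by apply: nneseries_lim_ge => n _ _; exact: ulim_ge0.
pose E N := [set n | (\sum_(i < N) mu n (B i n) < 1)%E].
have UE N : ultra_sets U (E N).
  have cvgN : (\sum_(i < N) mu n (B i n))%E @[n --> ultra_sets U] -->
      (\sum_(i < N) ulim (B i))%E.
    elim: N => [|N ih].
      rewrite big_ord0; under eq_fun do rewrite big_ord0; exact: cvg_cst.
    rewrite big_ord_recr /=; under eq_fun do rewrite big_ord_recr /=.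
    apply: cvgeD => //; last exact: ulim_cvg.
    apply: fin_num_adde_defl; exact: ulim_fin.
  apply: (cvgN [set r | (r < 1)%E]); apply: open_nbhs_nbhs; split => /=.
    exact: open_ereal_lt_ereal.
  exact: sum_lt1.
have pick n m : exists x : T n, forall i, (i < m)%N -> E i.+1 n -> ~ B i n x.
  elim: m => [|m [x ih]]; first by exists point.
  have [Em|nEm] := pselect (E m.+1 n); last first.
    exists x => i; rewrite ltnS leq_eqVlt => /predU1P[-> //|]; exact: ih.
  have [z Bz] : exists z, ~ (\big[setU/set0]_(i < m.+1) B i n) z.
    apply: contrapT => /forallNP BT; move: Em; rewrite /E /=; apply/negP.
    rewrite -leNgt.
    rewrite -(probability_setT (mu n)).
    apply: (@content_subadditive _ _ _ (mu n) setT (fun i => B i n)) => //.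
    by move=> z _; apply: contrapT; exact: (BT z).
  exists z => i im _ Biz; apply: Bz.
  by rewrite -(bigcup_mkord m.+1 (fun i => B i n)); exists i.
pose x n := projT1 (cid (pick n n)).
have [i _ /internal_sub Ui] : (\bigcup_i internal (B i))
  (ucls x) by exact: covB.
apply: (@filter_not_empty _ (ultra_sets U) _).
apply: filterS3 Ui (UE i.+1) (ultra_ge U i.+1) => n /= Bin En ltin.
by have := projT2 (cid (pick n n)) i ltin En.
Qed.

Definition ultra_space : Type := caratheodory_type theta.
HB.instance Definition _ := Measurable.on ultra_space.

Definition ultra_measure : set ultra_space -> \bar R := theta.
HB.instance Definition _ := isMeasure.Build _ _ _ ultra_measure
  (@caratheodory_measure0 _ _ theta) (@caratheodory_measure_ge0 _ _ theta)
  (@caratheodory_measure_sigma_additive _ _ theta).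
HB.instance Definition _ :=
  Measure_isProbability.Build _ _ _ ultra_measure theta_setT.

End ultraproduct_space.

Section ultraproduct_action.
Context (G : groupType) (R : realType) (U : nonprincipal_ultrafilter).
Context (a : nat -> pmp_action G R).

Let mu n := pmp_prob (a n).
Let sp n := pmp_space (a n).
Let X := ultra_space U mu.

Definition ultra_act (g : G) (x : X) : X :=
  ucls U (fun n => act g ((repr (x : uprod U sp) : useq sp) n)).

Lemma ultra_actE (g : G) (x : useq sp) :
  ultra_act g (ucls U x) = ucls U (fun n => act g (x n)).
Proof.
apply/uclsP; have /uclsP := ucls_repr (ucls U x).
by apply: filterS => n /= ->.
Qed.

Lemma ultra_act1 x : ultra_act 1%g x = x.
Proof.
rewrite -[x]ucls_repr ultra_actE; congr (ucls U _).
by apply: functional_extensionality_dep => n; exact: act_fun1.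
Qed.

Lemma ultra_actM g h x :
  ultra_act (g * h)%g x = ultra_act g (ultra_act h x).
Proof.
rewrite -[x]ucls_repr.
rewrite (ultra_actE (g * h)%g) (ultra_actE h) (ultra_actE g).
congr (ucls U _).
by apply: functional_extensionality_dep => n; exact: act_funM.
Qed.

Lemma measurable_act n g (A : set (sp n)) :
  measurable A -> measurable (act g @^-1` A).
Proof.
by move=> mA; rewrite -[X in measurable X]setTI; exact: measurable_act_fun.
Qed.

Lemma theta_act_le g (A : set (uprod U sp)) :
  (theta mu (ultra_act g @^-1` A) <= theta mu A)%E.
Proof.
apply/ereal_inf_le_tmp => _ [B [mB AB] <-].
exists (fun i n => act g @^-1` B i n).
  split; first by move=> i n; exact: measurable_act.
  move=> x /= /AB [i _ [y /= By yx]]; exists i => //.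
  exists (fun n => act g^-1 (y n)).
    by move=> n /=; rewrite /act -act_funM mulgV act_fun1.
  rewrite -(ultra_actE (g^-1)%g y) yx.
  by rewrite -ultra_actM mulVg ultra_act1.
apply: eq_eseriesr => i _; congr (lim _).
rewrite (_ : (fun n => mu n (act g @^-1` B i n)) = fun n => mu n (B i n))//.
by apply/funext => n; exact: act_fun_preserving.
Qed.

Lemma ultra_actK g (A : set X) :
  ultra_act g @^-1` (ultra_act (g^-1)%g @^-1` A) = A.
Proof.
by apply/seteqP; split => x /=; rewrite -ultra_actM mulVg ultra_act1.
Qed.

Lemma theta_act g (A : set (uprod U sp)) :
  theta mu (ultra_act g @^-1` A) = theta mu A.
Proof.
apply/eqP; rewrite eq_le theta_act_le /=.
rewrite -{1}[A](ultra_actK (g^-1)%g) invgK; exact: theta_act_le.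
Qed.

Lemma measurable_ultra_act g : measurable_fun setT (ultra_act g).
Proof.
move=> _ A mA; rewrite setTI.
suff : caratheodory_measurable (theta mu) (ultra_act g @^-1` A) by [].
move=> Y; rewrite -[Y](ultra_actK g) preimage_setC -!preimage_setI.
rewrite !theta_act.
have cA : caratheodory_measurable (theta mu) A by exact: mA.
by rewrite -cA theta_act.
Qed.

Definition ultraproduct : pmp_action G R :=
  PmpAction (@PmpOn G R _ X (@ultra_measure R U _ _ mu) ultra_act
    ultra_act1 ultra_actM measurable_ultra_act
    (fun g A _ => theta_act g A)).

End ultraproduct_action.

(* Main.v *)
Require Import Defs.
From HB Require Import structures.
From mathcomp Require Import all_boot all_order all_algebra finmap.
From mathcomp Require Import generic_quotient.
From mathcomp Require Import all_classical all_reals all_analysis.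
From mathcomp Require Import measurable_realfun.
From mathcomp Require Import ring lra.
Import Order.TTheory GRing.Theory Num.Theory.
Import numFieldNormedType.Exports.

(* The statistics of a k-partition form a point of a compact cube, so finite
   nets reduce weak containment to finitely many partitions at a time.
   Internal sets of the ultraproduct have as measure the ultralimit of the
   measures, and every measurable set is approximated by internal ones; hence
   partitions pass between [a_n] and [a_U] along [U] with the same statistics,
   and both [d(a_n, a_U)] and [d(a_U, a_n)] tend to 0 along [U].

   It remains to find [a_U] in [Act G] up to weak equivalence.  If
   [U]-almost all [a_n] live on [N] points, the pointwise ultralimit of these
   actions does.  Otherwise [a_U] is diffuse: code a point [x] by a real
   number whose ternary digits say which translates [g x] lie in which members
   of a countable family of sets that contains nets of partitions for all
   statistics and partitions into arbitrarily small pieces.  The distribution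
   function of the code makes it uniform and is invertible almost everywhere,
   so the coded action becomes an action on the standard space that is a
   factor of [a_U] approximating all its statistics.

   Limits are unique since the pseudo-metrics separate weak equivalence
   classes, and a sequence converges iff it does so, to the same limit, along
   every nonprincipal ultrafilter. *)

Set Implicit Arguments.
Unset Strict Implicit.
Unset Printing Implicit Defensive.

Local Open Scope classical_set_scope.
Local Open Scope ring_scope.

(** * The WC-topology *)

Section weak_topology.
Context (G : groupType) (R : realType).
Implicit Types (F : {fset G}) (k : nat) (x y z l : ActBar G R).

Lemma dbar_ge0 F k x y : 0 <= dbar F k x y.
Proof. by rewrite addr_ge0 ?dweak_ge0. Qed.

Lemma dbarxx F k x : dbar F k x x = 0.
Proof. by rewrite /dbar dweak_refl addr0. Qed.

Lemma dbarC F k x y : dbar F k x y = dbar F k y x.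
Proof. by rewrite /dbar addrC. Qed.

Lemma dbar_triangle F k x y z : dbar F k x z <= dbar F k x y + dbar F k y z.
Proof.
rewrite /dbar [leRHS]addrACA [X in _ <= _ + X]addrC lerD//; exact: dweak_triangle.
Qed.

(** Subbasic balls have arbitrary centres, but by the triangle inequality one that contains [l]
    contains a smaller ball centred at [l] for the same [F] and [k]. *)
Lemma cvg_wcP (T : Type) (H : set_system T) (f : T -> ActBar G R) l :
  Filter H ->
  f t @[t --> H] --> l <->
  forall F k e, 0 < e -> \forall t \near H, dbar F k l (f t) < e.
Proof.
move=> FH; split=> [fl F k e e0|fl A].
  apply: (fl [set y | dbar F k l y < e]); rewrite nbhsE.
  exists [set y | dbar F k l y < e]; last by [].
  split; last by rewrite /= dbarxx.
  exists [set [set y | dbar F k l y < e]]; last by rewrite bigcup_set1.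
  by move=> _ ->; apply: finI_from1; exists F, k, l, e.
rewrite nbhsE => -[_ [[B sB <-] [C BC Cl]] sA].
apply: filterS sA _; apply: (@filterS _ _ _ C); first by move=> ? ?; exists C.
have /sB [D sD DC] := BC; rewrite -DC; apply: filter_bigI => E DE.
have /sD := DE; rewrite inE => -[F [k [x [e [e0 EE]]]]].
have xl : dbar F k x l < e.
  by move: Cl; rewrite -DC => /(_ E DE); rewrite EE.
have le0 : 0 < e - dbar F k x l by rewrite subr_gt0.
rewrite EE /id/=; apply: filterS (fl F k _ le0) => t /=.
rewrite ltrBrDl; exact: le_lt_trans (dbar_triangle _ _ _ _ _).
Qed.

Lemma weakly_equivalent_sym (a b : pmp_action G R) :
  weakly_equivalent a b -> weakly_equivalent b a.
Proof. by case. Qed.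

Lemma weakly_equivalent_trans (b a c : pmp_action G R) :
  weakly_equivalent a b -> weakly_equivalent b c -> weakly_equivalent a c.
Proof.
by move=> [ab ba] [bc cb]; split; apply: (weakly_contained_trans (b := b)).
Qed.

Lemma ActBar_eqP x y : weakly_equivalent (repr x) (repr y) -> x = y.
Proof.
by move=> xy; rewrite -(reprK x) -(reprK y); apply/eqmodP/asboolP.
Qed.

Lemma dbar_eq0 x y : (forall F k, dbar F k x y = 0) -> x = y.
Proof.
move=> xy; apply: ActBar_eqP; split=> F k; apply/eqP.
  by have /eqP := xy F k; rewrite paddr_eq0 ?dweak_ge0// => /andP[].
by have /eqP := xy F k; rewrite paddr_eq0 ?dweak_ge0// => /andP[].
Qed.

Lemma cvg_wc_unique (T : Type) (H : set_system T) (f : T -> ActBar G R) x y :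
  ProperFilter H -> f t @[t --> H] --> x -> f t @[t --> H] --> y -> x = y.
Proof.
move=> FH /cvg_wcP fx /cvg_wcP fy; apply: dbar_eq0 => F k.
apply/eqP; rewrite eq_le dbar_ge0 andbT; apply/ler_addgt0Pr => e e0.
have e20 : 0 < e / 2 by rewrite divr_gt0.
have [t [xt yt]] := @filter_ex _ _ FH _ (filterI (fx F k _ e20) (fy F k _ e20)).
rewrite add0r [e]splitr (le_trans (dbar_triangle _ _ _ (f t) _))//.
by rewrite lerD ?(ltW xt)// dbarC ltW.
Qed.

End weak_topology.

(** * Nonprincipal ultrafilters on the natural numbers *)

Lemma ultra_cvg (U : nonprincipal_ultrafilter) : ultra_sets U --> \oo.
Proof. by move=> A [m _ mA]; apply: filterS (ultra_ge U m) => n /mA. Qed.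

(** [B] meets every tail, so the tails of [B] generate a proper filter; an ultrafilter extending it
    contains [B] and the complement of every singleton. *)
Lemma infinite_ultra (B : set nat) : ~ (\forall n \near \oo, ~ B n) ->
  exists U : nonprincipal_ultrafilter, ultra_sets U B.
Proof.
move=> nB.
have PF : ProperFilter (within B \oo).
  split; last exact: within_filter.
  by rewrite /within/= => h; apply: nB; apply: filterS h => n nB Bn; apply: nB.
have [V [UV BV]] := ultraFilterLemma PF.
have VB : V B by apply: BV; rewrite /within/=; apply: filterE.
have Vnp n : V <> principal_filter n.
  move=> Vn; have : V (~` [set n]).
    apply: BV; exists n.+1 => // m /= nm _ mn; move: nm.
    by rewrite mn ltnn.
  by rewrite Vn => /principal_filterP/=; apply.
by exists (NonprincipalUltrafilter UV Vnp).
Qed.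

(** * Partitions and their perturbations *)

Section partition_nets.
Context (G : groupType) (R : realType).
Implicit Types (a b : pmp_action G R) (F : {fset G}) (k : nat) (e : R).

Lemma part_dist_le F k a b (A : 'I_k -> set (pmp_space a))
    (B : 'I_k -> set (pmp_space b)) e :
  (forall f i j, f \in F -> `|part_stat A f i j - part_stat B f i j| <= e) ->
  part_dist F A B <= part_bound F k * e.
Proof.
move=> AB; rewrite /part_bound mulr_suml; apply: ler_sum => i _.
rewrite mulr_suml; apply: ler_sum => j _; rewrite mulr_suml.
rewrite [leLHS]big_seq [leRHS]big_seq.
by apply: ler_sum => f fF; rewrite mul1r AB.
Qed.

Lemma part_distC F k a b (A : 'I_k -> set (pmp_space a))
    (B : 'I_k -> set (pmp_space b)) : part_dist F A B = part_dist F B A.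
Proof.
apply: eq_bigr => i _; apply: eq_bigr => j _; apply: eq_bigr => f _.
exact: distrC.
Qed.

Lemma part_bound_ge0 F k : 0 <= part_bound F k :> R.
Proof. by do 3! (apply: sumr_ge0 => ? _). Qed.

Lemma part_bound_small F k e : 0 < e ->
  exists2 c : R, 0 < c & part_bound F k * c < e.
Proof.
move=> e0; exists (e / (part_bound F k + 1)).
  by rewrite divr_gt0// ltr_wpDl ?part_bound_ge0.
rewrite mulrA ltr_pdivrMr; last by rewrite ltr_wpDl ?part_bound_ge0.
by rewrite mulrC ltr_pM2l// ltrDl.
Qed.

Lemma same_truncn (x y M : R) : 0 < M -> 0 <= x -> 0 <= y ->
  Num.truncn (M * x) = Num.truncn (M * y) -> `|x - y| <= M^-1.
Proof.
move=> M0 x0 y0 xy.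
have /andP[x1 x2] := truncn_itv (mulr_ge0 (ltW M0) x0).
have /andP[y1 y2] := truncn_itv (mulr_ge0 (ltW M0) y0).
rewrite -(ler_pM2l M0) mulfV ?gt_eqF// -[X in X * _]gtr0_norm// -normrM mulrBr.
rewrite xy in x1 x2; move: x2 y2; rewrite -!natr1 => x2 y2.
rewrite ler_norml; apply/andP; split; lra.
Qed.

(** The unit cube of statistics is cut into finitely many cells, and one partition is chosen from
    every cell that occurs; partitions in a common cell are close. A cell that does not occur gets
    the dummy [A0]. *)
Lemma Part_net F k a e : 0 < e ->
  exists (I : finType) (N : I -> 'I_k -> set (pmp_space a)),
    (forall v, Part k a (N v)) /\
    forall A, Part k a A -> exists v, part_dist F A (N v) < e.
Proof.
move=> e0; have [c c0 ce] := part_bound_small F k e0.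
have [[A0 pA0]|nA0] := pselect (exists A, Part k a A); last first.
  exists void, (fun=> fun=> set0); split=> [[]|A pA].
  by exfalso; apply: nA0; exists A.
pose m := (Num.truncn c^-1).+1.
have mc : (m%:R : R)^-1 <= c.
  rewrite -[leRHS]invrK lef_pV2 ?posrE ?invr_gt0// ltW//.
  by have /andP[] := truncn_itv (ltW (etrans (invr_gt0 c) c0)).
(* Cells have side [1/m]. The index runs up to [m] inclusive because a statistic may equal 1; by
   [stat_lt] below, [inord] never takes its default value. *)
pose cell (A : 'I_k -> set (pmp_space a)) :
    {ffun 'I_k * 'I_k * F -> 'I_m.+1} :=
  [ffun t => inord (Num.truncn (m%:R * part_stat A (val t.2) t.1.1 t.1.2))].
have /choice[rep repP] (v : {ffun 'I_k * 'I_k * F -> 'I_m.+1}) :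
    exists B, Part k a B /\ forall A, Part k a A -> cell A = v -> cell B = v.
  have [[B [pB Bv]]|nB] := pselect (exists A, Part k a A /\ cell A = v).
    by exists B.
  by exists A0; split=> // A pA Av; exfalso; apply: nB; exists A.
exists {ffun 'I_k * 'I_k * F -> 'I_m.+1}, rep.
split=> [v|A pA]; first by have [] := repP v.
exists (cell A).
have [pB] := repP (cell A); set B := rep _ => /(_ A pA erefl) BA.
apply: le_lt_trans ce; apply: part_dist_le => f i j fF.
apply: le_trans mc; apply: same_truncn; rewrite ?part_stat_ge0//.
have stat_lt (C : 'I_k -> set (pmp_space a)) : Part k a C ->
    (Num.truncn (m%:R * part_stat C f i j) < m.+1)%N.
  move=> pC; rewrite ltnS -(ler_nat R).
  have h0 : 0 <= m%:R * part_stat C f i j by rewrite mulr_ge0 ?part_stat_ge0.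
  have /andP[h _] := truncn_itv h0.
  by rewrite (le_trans h)// ler_piMr// part_stat_le1.
have /ffunP/(_ (i, j, [` fF]%fset)) := BA; rewrite !ffunE /=.
by move=> /(congr1 val)/=; rewrite !inordK ?stat_lt.
Qed.

End partition_nets.

Section partition_perturbation.
Context (G : groupType) (R : realType).
Implicit Types (a b : pmp_action G R) (F : {fset G}) (k : nat).

Lemma measurable_act_preimage a (g : G) (A : set (pmp_space a)) :
  measurable A -> measurable (act g @^-1` A).
Proof.
by move=> mA; rewrite -[X in measurable X]setTI; exact: measurable_act_fun.
Qed.

Lemma measurable_act_image a (g : G) (A : set (pmp_space a)) :
  measurable A -> measurable (act g @` A).
Proof. by rewrite act_image; exact: measurable_act_preimage. Qed.

Lemma act_image_measure a (g : G) (A : set (pmp_space a)) :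
  measurable A -> pmp_prob a (act g @` A) = pmp_prob a A.
Proof. by rewrite act_image; exact: act_fun_preserving. Qed.

Lemma part_stat_EFin k a (A : 'I_k -> set (pmp_space a)) f i j :
  (forall i, measurable (A i)) ->
  (part_stat A f i j)%:E = pmp_prob a (A i `&` act f @` A j).
Proof.
move=> mA; rewrite /part_stat fineK// fin_num_measure//.
by apply: measurableI => //; exact: measurable_act_image.
Qed.

(** A point of [A i] and [f A j] that misses [C i] or [f C j] lies in [E] or in its translate by
    [f], both of measure at most [c]. *)
Lemma part_stat_sub k a (A C : 'I_k -> set (pmp_space a)) (E : set _) (c : R)
    f i j :
  (forall i, measurable (A i)) -> (forall i, measurable (C i)) ->
  measurable E -> (pmp_prob a E <= c%:E)%E ->
  (forall i, A i `<=` C i `|` E) ->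
  part_stat A f i j <= part_stat C f i j + c *+ 2.
Proof.
move=> mA mC mE Ec AC; rewrite -lee_fin mulr2n !EFinD.
rewrite !part_stat_EFin//.
have mfA := fun i => measurable_act_image f (mA i).
have mfC := fun i => measurable_act_image f (mC i).
have mfE := measurable_act_image f mE.
apply: (@le_trans _ _ (pmp_prob a
    ((C i `&` act f @` C j) `|` (E `|` act f @` E)))).
  apply: le_measure; rewrite ?inE.
  - exact: measurableI.
  - by apply: measurableU; [exact: measurableI|exact: measurableU].
  move=> x [Ax [y Ay yx]].
  have [Cx|Ex] := AC _ _ Ax; last by right; left.
  have [Cy|Ey] := AC _ _ Ay; last by right; right; exists y.
  by left; split=> //; exists y.
apply: le_trans (measureU2 _ _ _) _; rewrite ?leeD2l//.
- exact: measurableI.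
- exact: measurableU.
apply: le_trans (measureU2 _ _ _) _ => //.
by apply: leeD => //; move: Ec; rewrite -(act_image_measure f mE).
Qed.

(** The reverse inclusions follow, as both families are partitions: a point of [C l] outside [E]
    lies in some [A l'], hence in [C l'], so that [l' = l]. *)
Lemma part_dist_perturb F k a (A C : 'I_k -> set (pmp_space a)) (E : set _)
    (c : R) :
  Part k a A -> Part k a C -> measurable E -> (pmp_prob a E <= c%:E)%E ->
  (forall i, A i `<=` C i `|` E) ->
  part_dist F A C <= part_bound F k * (c *+ 2).
Proof.
move=> [mA tA cA] [mC tC cC] mE Ec AC; apply: part_dist_le => f i j _.
have CA l : C l `<=` A l `|` E.
  move=> x Cx; have [Ex|nEx] := pselect (E x); [by right|left].
  have [l' _ Al'] : (\bigcup_i A i) x by rewrite cA.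
  have [Cl'|//] := AC _ _ Al'.
  by rewrite (tC l l' I I)//; exists x.
have h1 := part_stat_sub f i j mA mC mE Ec AC.
have h2 := part_stat_sub f i j mC mA mE Ec CA.
by rewrite ler_norml; apply/andP; split; lra.
Qed.

End partition_perturbation.

Section disjointification.
Context (T : Type) (k : nat).
Implicit Types D : 'I_k -> set T.

(* Disjointifies a family and gives the uncovered points to the last piece. *)
Definition mkpart D (i : 'I_k) : set T :=
  (D i `|` [set _ | i.+1 = k]) `\` \bigcup_(j in [set j : 'I_k | (j < i)%N]) D j.

Lemma mkpart_uniq D i x : D i x -> (forall j, D j x -> j = i) -> mkpart D i x.
Proof.
move=> Dix Dx; split; first by left.
by move=> [j /= ji /Dx ji']; rewrite ji' ltnn in ji.
Qed.

Lemma trivIset_mkpart D : trivIset setT (mkpart D).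
Proof.
suff H (i j : 'I_k) x : (i < j)%N -> mkpart D i x -> mkpart D j x -> False.
  move=> i j _ _ [x [Dix Djx]]; apply/val_inj.
  by have [/H/(_ Dix Djx)//|/H/(_ Djx Dix)//|//] := ltngtP i j.
move=> ij [[Di|/= ik] _] [_ nDj]; first by apply: nDj; exists i.
by have := ltn_ord j; rewrite -{2}ik ltnS leqNgt ij.
Qed.

Lemma mkpart_cover D : (0 < k)%N -> \bigcup_i mkpart D i = setT.
Proof.
move=> k0; apply/seteqP; split=> // x _.
have [[i Di]|nD] := pselect (exists i, D i x).
  have [j /asboolP Dj jmin] := @arg_minnP _ i (fun i => `[< D i x >]) val
    (introT (asboolP _) Di).
  exists j => //; split; first by left.
  move=> [l /= lj /asboolP Dl]; have := jmin l Dl.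
  by rewrite leqNgt lj.
have k1 : (k.-1 < k)%N by rewrite ltn_predL.
exists (Ordinal k1) => //; split; first by right; rewrite /= prednK.
by move=> [l _ Dl]; apply: nD; exists l.
Qed.

End disjointification.

Lemma measurable_mkpart d (T : measurableType d) k (D : 'I_k -> set T) :
  (forall i, measurable (D i)) -> forall i, measurable (mkpart D i).
Proof.
move=> mD i; apply: measurableD.
  apply: measurableU => //.
  by have [->|ik] := pselect (i.+1 = k);
    [rewrite (_ : [set _ | _] = setT)//; apply/seteqP; split
    |rewrite (_ : [set _ | _] = set0)//; apply/seteqP; split].
by apply: fin_bigcup_measurable => //; exact: finite_finset.
Qed.

Lemma Part_mkpart (G : groupType) (R : realType) (a : pmp_action G R) k
    (D : 'I_k -> set (pmp_space a)) :
  (0 < k)%N -> (forall i, measurable (D i)) -> Part k a (mkpart D).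
Proof.
move=> k0 mD; split; [exact: measurable_mkpart|exact: trivIset_mkpart|].
exact: mkpart_cover.
Qed.

Lemma measure_bigU_le d (T : measurableType d) (R : realType)
    (mu : {measure set T -> \bar R}) k (E : 'I_k -> set T) (c : R) :
  (forall i, measurable (E i)) -> (forall i, mu (E i) <= c%:E)%E ->
  (mu (\big[setU/set0]_(i < k) E i) <= (k%:R * c)%:E)%E.
Proof.
elim: k E => [|k IH] E mE Ec; first by rewrite big_ord0 measure0 mul0r.
rewrite big_ord_recr/= -natr1 mulrDl mul1r EFinD.
apply: le_trans (measureU2 _ _ _) _ => //.
  exact: bigsetU_measurable.
apply: leeD; last exact: Ec.
apply: (IH (fun i => E (widen_ord (leqnSn k) i))) => i.
  exact: mE.
exact: Ec.
Qed.

(** * Measures of internal sets *)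

Lemma ultra_setC (U : nonprincipal_ultrafilter) (P : set nat) :
  ~ ultra_sets U P -> ultra_sets U (~` P).
Proof. by have [] := in_ultra_setVsetC P (ultra_sets_ultra U). Qed.

Section internal_sets.
Context (R : realType) (U : nonprincipal_ultrafilter).
Context (d : nat -> measure_display) (T : forall n, measurableType (d n)).
Context (mu : forall n, probability (T n) R).

(* Unlike [internal A], which is empty as soon as one [A n] is, this set only
   depends on the values of [A] along the ultrafilter. *)
Definition uset (A : forall n, set (T n)) : set (ultra_space U mu) :=
  [set z | ultra_sets U [set n | A n ((repr (z : uprod U T) : useq T) n)]].

Lemma usetE A (x : useq T) :
  uset A (ucls U x) <-> ultra_sets U [set n | A n (x n)].
Proof.
have /uclsP xx := ucls_repr (ucls U x).
by split; apply: filterS2 xx => n /= ->.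
Qed.

Lemma internal_uset A : internal A `<=` uset A.
Proof.
by move=> z; rewrite -(ucls_repr z) => /internal_sub Az; apply/usetE.
Qed.

Lemma usetC A : uset (fun n => ~` A n) = ~` uset A.
Proof.
apply/seteqP; split=> z; last exact: ultra_setC.
move=> nA A'; apply: (@filter_not_empty _ (ultra_sets U) _).
by apply: filterS2 nA A' => n.
Qed.

Lemma usetI A B : uset (fun n => A n `&` B n) = uset A `&` uset B.
Proof.
apply/seteqP; split=> z.
  by move=> h; split; apply: filterS h => n /= [].
by move=> [Az Bz]; apply: filterS2 Az Bz => n.
Qed.

Lemma usetD A B : uset (fun n => A n `\` B n) = uset A `\` uset B.
Proof. by rewrite setDE -usetC -usetI; congr uset. Qed.

Lemma usetU A B : uset (fun n => A n `|` B n) = uset A `|` uset B.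
Proof.
rewrite -[RHS]setCK setCU -!usetC -usetI -usetC.
by congr uset; apply: functional_extensionality_dep => n; rewrite setCI !setCK.
Qed.

Lemma uset0 : uset (fun=> set0) = set0.
Proof.
by apply/seteqP; split=> // z /filter_ex[n].
Qed.

Lemma uset_bigcup_lt N (A : nat -> forall n, set (T n)) :
  uset (fun n => \bigcup_(i < N) A i n) = \bigcup_(i < N) uset (A i).
Proof.
rewrite bigcup_mkord; under [X in uset X]functional_extensionality_dep
  do rewrite bigcup_mkord.
elim: N => [|N IH].
  rewrite big_ord0 -uset0; congr uset.
  by apply: functional_extensionality_dep => n; rewrite big_ord0.
rewrite big_ord_recr/= -IH -usetU; congr uset.
by apply: functional_extensionality_dep => n; rewrite big_ord_recr.
Qed.

Local Notation measurable_seq A := (forall n, measurable (A n)) (only parsing).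

Lemma near_ulim A (B : forall n, set (T n)) :
  measurable_seq A ->
  ultra_sets U [set n | A n = B n] -> ulim U mu B = ulim U mu A.
Proof.
move=> mA AB; apply: cvg_lim => //.
apply: cvg_trans (ulim_cvg mA); apply: near_eq_cvg.
by apply: filterS AB => n /= ->.
Qed.

Lemma ulimU A B : measurable_seq A -> measurable_seq B ->
  (forall n, A n `&` B n = set0) ->
  ulim U mu (fun n => A n `|` B n) = (ulim U mu A + ulim U mu B)%E.
Proof.
move=> mA mB AB; apply: cvg_lim => //.
under eq_fun do rewrite measureU//.
apply: cvgeD; [|exact: ulim_cvg..].
by apply: fin_num_adde_defl; exact: ulim_fin.
Qed.

(** If almost all [A n] are nonempty, the empty ones are replaced by the whole space, which changes
    neither the [uset] nor the ultralimit. Otherwise almost all are empty and the constant empty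
    sequence serves. *)
Lemma uset_internal A : measurable_seq A ->
  exists B, [/\ measurable_seq B, uset A = internal B &
               ulim U mu B = ulim U mu A].
Proof.
move=> mA; pose E := [set n | A n !=set0].
have [UE|/ultra_setC UE] := pselect (ultra_sets U E).
  pose B n := if pselect (E n) then A n else setT.
  have BA : ultra_sets U [set n | A n = B n].
    by apply: filterS UE => n En /=; rewrite /B; case: pselect.
  have mB n : measurable (B n).
    by rewrite /B; case: pselect => ? /=; [exact: mA|exact: measurableT].
  exists B; split=> //; last exact: near_ulim.
  apply/seteqP; split=> [z|].
    rewrite -(ucls_repr z) => /usetE; set x := repr z => Ax.
    (* The representative is corrected on a negligible set of indices: it keeps [x n] where this
       lies in [A n] and takes any point of [B n] elsewhere. *)
    have yex n : exists y, B n y /\ (A n (x n) -> y = x n).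
      have [Axn|nAxn] := pselect (A n (x n)).
        exists (x n); split=> //; rewrite /B; case: pselect => //.
      rewrite /B; case: pselect => [[y Ay]|nE] /=; first by exists y; split.
      by exists point; split.
    exists (fun n => projT1 (cid (yex n))).
      by move=> n; have [] := projT2 (cid (yex n)).
    apply/uclsP; apply: filterS Ax => n Axn.
    exact: (projT2 (cid (yex n))).2.
  apply: subset_trans (@internal_uset B) _ => z Bz.
  by apply: filterS2 BA Bz => n /= ->.
have A0 : ultra_sets U [set n | A n = set0].
  by apply: filterS UE => n /= nE; apply/eqP/negPn/negP => /set0P.
exists (fun=> set0); split=> //.
- apply/seteqP; split=> [z Az|z].
    exfalso; apply: (@filter_not_empty _ (ultra_sets U) _).
    by apply: filterS2 A0 Az => n /= ->.
  by move=> /internal_uset; rewrite uset0.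
- by apply: near_ulim => //.
Qed.

(** Lets covers by [uset]s, which respect Boolean operations, replace the covers by [internal] sets
    that define [theta]. *)
Lemma theta_uset_cover (Y : set (uprod U T)) (B : nat -> forall n, set (T n)) :
  (forall i, measurable_seq (B i)) -> Y `<=` \bigcup_i uset (B i) ->
  (theta mu Y <= \sum_(i <oo) ulim U mu (B i))%E.
Proof.
move=> mB YB.
have /choice[C CP] i := uset_internal (mB i).
rewrite [leRHS](_ : _ = (\sum_(i <oo) ulim U mu (C i))%E); last first.
  by apply: eq_eseriesr => i _; have [_ _ ->] := CP i.
apply: ereal_inf_lbound; exists C => //; split.
  by move=> i n; have [] := CP i.
by move=> z /YB[i _]; have [_ -> _] := CP i; exists i.
Qed.

Lemma theta_uset_le A : measurable_seq A ->
  (theta mu (uset A : set (uprod U T)) <= ulim U mu A)%E.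
Proof.
move=> mA; have [B [mB -> <-]] := uset_internal mA.
exact: theta_le_ulim.
Qed.

(** Caratheodory's criterion: a cover of [Y], cut along [A], yields covers of the two parts of [Y],
    and additivity of ultralimits keeps the total weight. *)
Lemma measurable_uset A : measurable_seq A -> measurable (uset A).
Proof.
move=> mA.
suff : caratheodory_measurable (theta mu) (uset A : set (uprod U T)) by [].
apply: le_caratheodory_measurable => Y.
apply: le_ereal_inf_tmp => _ [B [mB YB] <-].
rewrite [leRHS](_ : _ = (\sum_(i <oo) (ulim U mu (fun n => B i n `&` A n) +
    ulim U mu (fun n => B i n `\` A n)))%E); last first.
  apply: eq_eseriesr => i _; rewrite -ulimU.
  - by congr ulim; apply: functional_extensionality_dep => n; rewrite setUIDK.
  - by move=> n; exact: measurableI.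
  - by move=> n; exact: measurableD.
  - by move=> n; rewrite setDE setIACA setICr setI0.
have BA i n : measurable (B i n `&` A n) by exact: measurableI.
have BDA i n : measurable (B i n `\` A n) by exact: measurableD.
rewrite nneseriesD; last 2 first.
- by move=> i _ _; exact: ulim_ge0.
- by move=> i _ _; exact: ulim_ge0.
apply: leeD; apply: theta_uset_cover => // z [/YB[i _ /internal_uset Bz] Az].
  by exists i => //; rewrite usetI.
by exists i => //; rewrite usetD.
Qed.

(* Both [uset A] and its complement have measure at most their ultralimits,
   and the two bounds add up to the total mass. *)
Lemma ultra_measure_uset A : measurable_seq A ->
  @ultra_measure R U d T mu (uset A) = ulim U mu A.
Proof.
move=> mA; pose P := @ultra_measure R U d T mu.
have mAC n : measurable (~` A n) by exact: measurableC.
have uA := measurable_uset mA.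
apply/eqP; rewrite eq_le theta_uset_le//=.
have := theta_uset_le mAC; rewrite usetC.
have -> : theta mu (~` uset A : set (uprod U T)) = (1 - P (uset A))%E.
  exact: (@probability_setC _ _ _
    [the probability _ _ of @ultra_measure R U d T mu] _ uA).
have -> : ulim U mu (fun n => ~` A n) = (1 - ulim U mu A)%E.
  rewrite -(@ulim_cst _ U _ _ mu (fun=> setT) 1%E); last first.
    by move=> n; exact: probability_setT.
  rewrite -(_ : (fun n => A n `|` ~` A n) = fun=> setT); last first.
    by apply: functional_extensionality_dep => n; rewrite setUv.
  rewrite ulimU//; last by move=> n; rewrite setICr.
  by rewrite [X in (X - _)%E]addeC addeK// ulim_fin.
have := @ulim_fin R U d T mu A mA.
have : P (uset A) \is a fin_num by exact: fin_num_measure.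
rewrite -/P; case: (P _) => [p||]//; case: (ulim _ _ _) => [l||]// _ _.
by rewrite -!EFinB !lee_fin lerD2l lerN2.
Qed.

(** A cover of [A] by internal sets of total weight below [P A + e] is truncated: by continuity from
    below, finitely many of its sets exhaust the union [D] up to [e], and a finite union of [uset]s
    is again a [uset]. *)
Lemma uset_approx (A : set (ultra_space U mu)) (e : R) : measurable A -> 0 < e ->
  exists B, [/\ measurable_seq B,
    (@ultra_measure R U d T mu (A `\` uset B) <= e%:E)%E &
    (@ultra_measure R U d T mu (uset B `\` A) <= e%:E)%E].
Proof.
move=> mA e0; pose P := [the probability _ _ of @ultra_measure R U d T mu].
have PA : P A \is a fin_num by exact: fin_num_measure.
have : (P A < P A + e%:E)%E by rewrite lteDl// lte_fin.
move=> /ereal_inf_lt[_ [B [mB AB] <-] Blt].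
pose C N := uset (fun n => \bigcup_(i < N) B i n).
have mBN N n : measurable (\bigcup_(i < N) B i n).
  by apply: bigcup_measurable => i _.
have mC N : measurable (C N) by exact: measurable_uset.
pose D := \bigcup_N C N.
have mD : measurable D by exact: bigcupT_measurable.
have CE N : C N = \bigcup_(i < N) uset (B i) by exact: uset_bigcup_lt.
have DE : D = \bigcup_i uset (B i).
  apply/seteqP; split=> z.
    by move=> [N _]; rewrite CE => -[i _ Bz]; exists i.
  by move=> [i _ Bz]; exists i.+1 => //; rewrite CE; exists i => /=.
have AD : A `<=` D.
  by rewrite DE => z /AB[i _ /internal_uset Bz]; exists i.
have PDA : (P (D `\` A) < e%:E)%E.
  rewrite measureD//; last by rewrite ltey_eq fin_num_measure.
  rewrite (_ : D `&` A = A); last exact/setIidPr.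
  rewrite lteBlDr// addeC (le_lt_trans _ Blt)//.
  by apply: theta_uset_cover => //; rewrite DE.
have ndC : nondecreasing_seq C.
  move=> N M NM; apply/subsetPset; rewrite !CE => z [i /= iN Bz].
  by exists i => //=; exact: leq_trans NM.
have cvC : P (C N) @[N --> \oo] --> P D.
  exact: nondecreasing_cvg_mu.
have [N CN] : exists N, (P D - e%:E < P (C N))%E.
  have h : (P D - e%:E < P D)%E.
    by rewrite lteBlDr// lteDl ?lte_fin// fin_num_measure.
  have [N _ /(_ N (leqnn N))] : \forall N \near \oo, (P D - e%:E < P (C N))%E.
    apply: (cvC [set x | (P D - e%:E < x)%E]); apply: open_nbhs_nbhs.
    by split => //; exact: open_ereal_gt_ereal.
  by exists N.
exists (fun n => \bigcup_(i < N) B i n); split; first exact: mBN.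
- rewrite -/(C N); apply: (@le_trans _ _ (P (D `\` C N))).
    by apply: le_measure; rewrite ?inE; [exact: measurableD..|exact: setSD].
  rewrite measureD//; last by rewrite ltey_eq fin_num_measure.
  rewrite (_ : D `&` C N = C N); last by apply/setIidPr; exact: bigcup_sup.
  by rewrite leeBlDr ?fin_num_measure// -leeBlDl ?fin_num_measure// ltW.
- rewrite -/(C N); apply: le_trans (ltW PDA).
  apply: le_measure; rewrite ?inE; [exact: measurableD..|].
  by apply: setSD; exact: bigcup_sup.
Qed.

End internal_sets.
Arguments uset {R} U {d T} mu A.

(** * Limits along an ultrafilter *)

Section ultraproduct_limit.
Context (G : groupType) (R : realType) (U : nonprincipal_ultrafilter).
Context (r : nat -> pmp_action G R).

Let mu n := pmp_prob (r n).
Let aU := ultraproduct U r.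

Lemma ultra_act_uset (g : G) (A : forall n, set (pmp_space (r n))) :
  @act _ _ aU g @` (uset U mu A) = uset U mu (fun n => act g @` A n).
Proof.
have -> : (fun n => act g @` A n) = (fun n => act (g^-1)%g @^-1` A n).
  by apply: functional_extensionality_dep => n; rewrite act_image.
rewrite (@act_image _ _ aU g (uset U mu A)).
apply/seteqP; split=> z.
  by rewrite -(ucls_repr z) /act/= ultra_actE => /usetE Az; apply/usetE.
rewrite -(ucls_repr z) /act/= ultra_actE => /usetE Az; exact/usetE.
Qed.

Variable k : nat.
Implicit Types A : forall n, 'I_k -> set (pmp_space (r n)).

Definition upart A : 'I_k -> set (pmp_space aU) :=
  fun i => uset U mu (fun n => A n i).

(** Covering uses that there are finitely many pieces: if [z] missed each of them, then for almost
    all [n] its coordinate would miss every [A n i] at once. *)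
Lemma Part_upart A : (forall n, Part k (r n) (A n)) -> Part k aU (upart A).
Proof.
move=> pA; split.
- by move=> i; apply: measurable_uset => n; have [+ _ _] := pA n; apply.
- move=> i j _ _ [z [Az Bz]]; have [n [An Bn]] := filter_ex (filterI Az Bz).
  have [_ tA _] := pA n; apply: (tA i j I I).
  by eexists; split; [exact: An|exact: Bn].
- apply/seteqP; split=> // z _; apply: contrapT => nz.
  have [n Hn] : exists n, forall i, ~ A n i ((repr (z : uprod U _) : useq _) n).
    apply: (@filter_ex _ (ultra_sets U)); apply: filter_forall => i; apply: ultra_setC => zi.
    by apply: nz; exists i.
  have [_ _ cA] := pA n.
  have [i _ Ai] : (\bigcup_i A n i) ((repr (z : uprod U _) : useq _) n).
    by rewrite cA.
  exact: Hn Ai.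
Qed.

Lemma part_stat_upart A f i j : (forall n, Part k (r n) (A n)) ->
  part_stat (A n) f i j @[n --> ultra_sets U] --> part_stat (upart A) f i j.
Proof.
move=> pA.
have mA n l : measurable (A n l) by have [+ _ _] := pA n; apply.
have mAA n : measurable (A n i `&` act f @` A n j).
  by apply: measurableI => //; exact: measurable_act_image.
apply: fine_cvg.
rewrite (part_stat_EFin f i j); last by have [] := Part_upart pA.
rewrite /upart ultra_act_uset -usetI.
have -> : pmp_prob aU (uset U mu (fun n => A n i `&` act f @` A n j)) =
    ulim U mu (fun n => A n i `&` act f @` A n j).
  exact: ultra_measure_uset.
exact: ulim_cvg.
Qed.

Lemma part_dist_upart F A (e : R) : 0 < e -> (forall n, Part k (r n) (A n)) ->
  \forall n \near ultra_sets U, part_dist F (upart A) (A n) < e.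
Proof.
move=> e0 pA; have [c c0 ce] := part_bound_small F k e0.
suff : \forall n \near ultra_sets U, forall t : 'I_k * 'I_k * F,
    `|part_stat (upart A) (val t.2) t.1.1 t.1.2 -
      part_stat (A n) (val t.2) t.1.1 t.1.2| <= c.
  apply: filterS => n Hn; apply: le_lt_trans ce.
  by apply: part_dist_le => f i j fF; exact: (Hn (i, j, [` fF]%fset)).
apply: filter_forall => -[[i j] f] /=.
by have /cvgrPdist_le/(_ c c0) := @part_stat_upart A (val f) i j pA.
Qed.

(** The pieces of [A] are approximated by [uset]s, and [mkpart] makes the approximations disjoint in
    each coordinate. The ultraproduct of the resulting partitions agrees with [A] off a small set
    [E]. *)
Lemma dpart_from_ultraproduct F (A : 'I_k -> set (pmp_space aU)) (e : R) :
  0 < e -> Part k aU A ->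
  \forall n \near ultra_sets U, dpart F (r n) A < e.
Proof.
move=> e0 pA; have [mA tA cA] := pA.
have k0 : (0 < k)%N.
  have : [set: pmp_space aU] point by [].
  by rewrite -cA => -[i _ _]; exact: leq_ltn_trans (ltn_ord i).
have e20 : 0 < e / 2 by rewrite divr_gt0.
have [c c0 ce] := part_bound_small F k e20.
(* Each of the [k] symmetric differences has measure at most [2h], so [E] has measure at most
   [2kh = c/2], which the perturbation bound doubles to [c]. *)
pose h := c / (k%:R * 4).
have h0 : 0 < h by rewrite divr_gt0// mulr_gt0// ltr0n.
have /choice[D DP] i := uset_approx (mA i) h0.
have mD n i : measurable (D i n) by have [] := DP i.
pose C n := mkpart (fun i => D i n).
have pC n : Part k (r n) (C n) by exact: Part_mkpart.
have muD i : measurable (uset U mu (D i)) by apply: measurable_uset => n.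
pose E := \big[setU/set0]_(i < k)
  ((A i `\` uset U mu (D i)) `|` (uset U mu (D i) `\` A i)).
have mE : measurable E.
  by apply: bigsetU_measurable => i _; apply: measurableU; exact: measurableD.
have Ec : (pmp_prob aU E <= (c / 2)%:E)%E.
  have -> : c / 2 = k%:R * (h *+ 2).
    by rewrite /h mulr2n; field; rewrite pnatr_eq0 -lt0n.
  apply: measure_bigU_le => i.
    by apply: measurableU; exact: measurableD.
  have [_ h1 h2] := DP i; rewrite mulr2n EFinD.
  apply: le_trans (measureU2 _ _ _) (leeD h1 h2); exact: measurableD.
have AC i : A i `<=` upart C i `|` E.
  move=> z Az; have [Ez|nEz] := pselect (E z); [by right|left].
  (* Off [E], [z] lies in [uset U mu (D j)] only for [j = i]; hence for almost all [n] its
     coordinate lies in [D i n] alone, and [mkpart] keeps it in piece [i]. *)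
  have Dz j : uset U mu (D j) z <-> j = i.
    have : ~ ((A j `\` uset U mu (D j)) `|` (uset U mu (D j) `\` A j)) z.
      by apply: contra_not nEz => zj; rewrite /E (bigD1 j)//=; left.
    move=> /not_orP[h1 h2]; split=> [Dj|ji].
      have Aj : A j z by apply: contrapT => nA; apply: h2.
      by apply: (tA _ _ I I); exists z.
    by rewrite ji in h1 *; apply: contrapT => nDz; apply: h1.
  have : \forall n \near ultra_sets U, forall j,
      D j n ((repr (z : uprod U _) : useq _) n) <-> j = i.
    apply: filter_forall => j; have [ji|ji] := pselect (j = i).
      by have := (Dz j).2 ji; apply: filterS => n Dj; split.
    have /ultra_setC : ~ uset U mu (D j) z by move=> /(Dz j).1.
    by apply: filterS => n nDj; split.
  apply: filterS => n Dn; apply: mkpart_uniq; first exact: (Dn i).2.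
  by move=> j /(Dn j).1.
have pCU := Part_upart pC.
apply: filterS (part_dist_upart F e20 pC) => n Cn.
apply: le_lt_trans (dpart_le _ _ (pC n)) _.
apply: le_lt_trans (part_dist_triangle _ _ (upart C) _) _.
rewrite [e]splitr ler_ltD//; apply: le_trans (ltW ce).
rewrite (_ : c = (c / 2) *+ 2); last by rewrite -mulr_natr divfK.
exact: part_dist_perturb AC.
Qed.

End ultraproduct_limit.

Section weak_limits.
Context (G : groupType) (R : realType) (U : nonprincipal_ultrafilter).
Context (r : nat -> pmp_action G R) (F : {fset G}) (k : nat).

(** A finite net makes the set of good indices [n] independent of the partition. *)
Lemma dweak_from_ultraproduct (e : R) : 0 < e ->
  \forall n \near ultra_sets U, dweak F k (ultraproduct U r) (r n) < e.
Proof.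
move=> e0; have e40 : 0 < e / 4 by rewrite divr_gt0.
have [I [N [pN netN]]] := Part_net F k (ultraproduct U r) e40.
have : \forall n \near ultra_sets U, forall v, dpart F (r n) (N v) < e / 4.
  by apply: filter_forall => v; exact: dpart_from_ultraproduct.
(* The net, the infimum in [dpart] and [Hn] cost [e/4] each; the spare quarter restores strictness
   after the supremum. *)
apply: filterS => n Hn; apply: (@le_lt_trans _ _ (e * 3 / 4)); last by lra.
apply: dweak_lub => [|A pA]; first by lra.
have [v Av] := netN A pA; have [B pB NB] := dpart_adherent F (r n) (pN v) e40.
apply: le_trans (dpart_le _ _ pB) _.
apply: le_trans (part_dist_triangle _ _ (N v) _) _.
have := Hn v; lra.
Qed.

(** Otherwise almost every [r n] has a partition [A n] further than [e / 2] from all partitions of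
    the ultraproduct, whereas [upart A] comes closer than that to [A n] along [U]. *)
Lemma dweak_to_ultraproduct (e : R) : 0 < e ->
  \forall n \near ultra_sets U, dweak F k (r n) (ultraproduct U r) < e.
Proof.
move=> e0; apply: contrapT => /ultra_setC Ue.
have e20 : 0 < e / 2 by rewrite divr_gt0.
pose far n A := Part k (r n) A /\ e / 2 < dpart F (ultraproduct U r) A.
have farP n : ~ dweak F k (r n) (ultraproduct U r) < e -> exists A, far n A.
  move=> /negP; rewrite -leNgt => en; apply: contrapT => /forallNP nfar.
  have : dweak F k (r n) (ultraproduct U r) <= e / 2.
    apply: dweak_lub => [|A pA]; first exact: ltW.
    by rewrite leNgt; apply/negP => /(conj pA); exact: nfar.
  by lra.
have [n0 /farP[A0 [pA0 _]]] := filter_ex Ue.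
have Aex n : exists A, Part k (r n) A /\
    (~ dweak F k (r n) (ultraproduct U r) < e -> far n A).
  have [/farP[A fA]|nfar] := pselect (~ dweak F k (r n) (ultraproduct U r) < e).
    by exists A; split=> //; case: fA.
  have [A pA] : Part k (r n) !=set0 by apply: Part_nonempty; exists A0; exact: pA0.
  by exists A; split.
pose A n := projT1 (cid (Aex n)).
have pA n : Part k (r n) (A n) by have [] := projT2 (cid (Aex n)).
have [n [An Un]] := filter_ex (filterI (@part_dist_upart _ _ U r k F A _ e20 pA) Ue).
have [_ /(_ Un)[_]] := projT2 (cid (Aex n)); rewrite -/(A n) => eA.
have := dpart_le F (A n) (Part_upart U pA).
by rewrite part_distC; lra.
Qed.

End weak_limits.

(** * Ternary codes and the uniform distribution *)

Section ternary.
Context {R : realType}.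
Implicit Types (b : nat -> bool) (t : R) (n : nat).

Definition tern_sum b n : R := \sum_(i < n) (b i)%:R / 3 ^+ i.

(* Digits are restricted to 0 and 1, which makes the expansion injective. *)
Definition tern b : R := limn (tern_sum b).

Lemma tern_sumS b n :
  tern_sum b n.+1 = (b 0%N)%:R + tern_sum (fun i => b i.+1) n / 3.
Proof.
rewrite /tern_sum big_ord_recl/= expr0 divr1; congr (_ + _).
rewrite mulr_suml; apply: eq_bigr => i _.
by rewrite /bump/= add1n exprSr invfM mulrA.
Qed.

Lemma tern_sum_ge0 b n : 0 <= tern_sum b n.
Proof. by apply: sumr_ge0 => i _; rewrite divr_ge0// exprn_ge0. Qed.

Lemma tern_sum_le b n : tern_sum b n <= 3 / 2.
Proof.
elim: n b => [|n IH] b; first by rewrite /tern_sum big_ord0; lra.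
rewrite tern_sumS; have := IH (fun i => b i.+1).
by case: (b 0%N) => /=; lra.
Qed.

Lemma is_cvg_tern b : cvgn (tern_sum b).
Proof.
apply: nondecreasing_is_cvgn.
  apply/nondecreasing_seqP => n.
  by rewrite /tern_sum big_ord_recr/= lerDl divr_ge0// exprn_ge0.
by exists (3 / 2) => _ [n _ <-]; exact: tern_sum_le.
Qed.

Lemma tern_ge0 b : 0 <= tern b.
Proof.
apply: limr_ge; first exact: is_cvg_tern.
by near=> n; exact: tern_sum_ge0.
Unshelve. all: by end_near. Qed.

Lemma tern_le b : tern b <= 3 / 2.
Proof.
apply: limr_le; first exact: is_cvg_tern.
by near=> n; exact: tern_sum_le.
Unshelve. all: by end_near. Qed.

Lemma tern_rec b : tern b = (b 0%N)%:R + tern (fun i => b i.+1) / 3.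
Proof.
apply/cvg_lim => //; rewrite -cvg_shiftS/=.
under eq_fun do rewrite tern_sumS.
by apply: cvgD; [exact: cvg_cst|apply: cvgMl; exact: is_cvg_tern].
Qed.

(** The digits after the first contribute at most [1/2], so comparison with 1 detects the first
    one. *)
Lemma tern_digit0 b : (1 <= tern b) = b 0%N.
Proof.
rewrite tern_rec; have := tern_ge0 (fun i => b i.+1).
have := tern_le (fun i => b i.+1).
by case: (b 0%N) => /= h1 h2; [apply/idP; lra|apply/negbTE; rewrite -ltNge; lra].
Qed.

(** The [n]-fold shift of the expansion, computed from the number alone; being defined for every
    real [t], it makes each digit a measurable function of [t]. *)
Fixpoint tern_rem n t : R :=
  if n is n'.+1 then 3 * (tern_rem n' t - (1 <= tern_rem n' t)%R%:R) else t.

Definition tern_digit n t := 1 <= tern_rem n t.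

Lemma tern_remE n b : tern_rem n (tern b) = tern (fun i => b (n + i)%N).
Proof.
elim: n => [//|n IH] /=; rewrite IH tern_digit0 addn0 tern_rec addn0.
have -> : (fun i => b (n + i.+1)%N) = (fun i => b (n.+1 + i)%N).
  by apply/funext => i; rewrite addnS.
by field.
Qed.

Lemma tern_digitE n b : tern_digit n (tern b) = b n.
Proof. by rewrite /tern_digit tern_remE tern_digit0 addn0. Qed.

Lemma measurable_tern_rem n : measurable_fun [set: R] (tern_rem n).
Proof.
elim: n => [|n IH] /=; first exact: measurable_id.
apply: measurable_funM => //; apply: measurable_funB => //.
rewrite (_ : (fun _ => _) = (fun t => if 1 <= tern_rem n t then 1 else 0)).
  by apply: measurable_fun_ifT => //; exact: measurable_fun_ler.
by apply/funext => t; case: ifP.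
Qed.

Lemma measurable_tern_digit n : measurable [set t | tern_digit n t].
Proof.
have : measurable_fun [set: R] (tern_digit n).
  by apply: measurable_fun_ler => //; exact: measurable_tern_rem.
by move=> /(_ measurableT [set true]); rewrite setTI; apply.
Qed.

Lemma measurable_tern d (T : measurableType d) (c : nat -> T -> bool) :
  (forall n, measurable [set x | c n x]) ->
  measurable_fun [set: T] (fun x => tern (c ^~ x)).
Proof.
move=> mc; apply: (@measurable_fun_cvg _ _ _ _ (fun n x => tern_sum (c ^~ x) n)).
  move=> n; apply: measurable_sum => i; apply: measurable_funM => //.
  rewrite (_ : (fun _ => _) = (fun x => if c i x then 1 else 0)).
    apply: measurable_fun_ifT => //; apply: (measurable_fun_bool true).
    by rewrite setTI; exact: mc.
  by apply/funext => t; case: ifP.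
by move=> x _; exact: is_cvg_tern.
Qed.

End ternary.

Lemma std_probE (R : realType) (A : set (measurableTypeR R)) : measurable A ->
  std_prob R A = lebesgue_measure (A `&` `[0, 1]%classic).
Proof.
move=> mA; rewrite /std_prob/= /uniform_prob integral_uniform_pdf.
have mA01 : measurable (A `&` `[0, 1]%classic) by exact: measurableI.
rewrite (eq_integral (cst 1%E)); last first.
  move=> x; rewrite inE => -[_ /=]; rewrite in_itv/= /uniform_pdf => ->.
  by rewrite subr0 invr1.
by rewrite integral_cst// mul1e.
Qed.

Lemma std_prob_ray (R : realType) (s : R) : 0 <= s <= 1 ->
  std_prob R `]-oo, s]%classic = s%:E.
Proof.
move=> /andP[s0 s1]; rewrite std_probE//.
rewrite (_ : _ `&` _ = `[0, s]%classic); last first.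
  apply/seteqP; split=> x /=; rewrite !in_itv/=.
    by move=> [-> /andP[->]].
  by move=> /andP[-> xs]; rewrite xs (le_trans xs).
rewrite lebesgue_measure_itv/= lte_fin; case: ltgtP s0 => // [_ _|<- _//].
by rewrite -EFinB subr0.
Qed.

Lemma std_prob_set1 (R : realType) (s : R) : std_prob R [set s] = 0%E.
Proof.
rewrite std_probE//; apply/eqP; rewrite eq_le measure_ge0 andbT.
rewrite -(lebesgue_measure_set1 s); apply: le_measure; rewrite ?inE//.
exact: measurableI.
Qed.

(** Rays generate the Borel sets, and those with endpoint outside []0, 1[] are squeezed by rays with
    endpoint inside. *)
Lemma std_prob_unique (R : realType) (P : probability (measurableTypeR R) R) :
  (forall s, 0 < s < 1 -> P `]-oo, s]%classic = s%:E) ->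
  forall A, measurable A -> P A = std_prob R A.
Proof.
move=> Ps.
have Pray s : P `]-oo, s]%classic = std_prob R `]-oo, s]%classic.
  have [s0|s0] := leP s 0.
    transitivity (0%E : \bar R); last first.
      apply/esym/eqP; rewrite eq_le measure_ge0 andbT.
      rewrite -[leRHS](@std_prob_ray R 0) ?lexx ?ler01//.
      by apply: le_measure; rewrite ?inE//; apply: subitvPr; rewrite bnd_simp.
    apply/eqP; rewrite eq_le measure_ge0 andbT; apply/lee_addgt0Pr => e e0.
    pose h := Num.min e (1 / 2).
    have h0 : 0 < h by rewrite lt_min e0 divr_gt0.
    have h1 : h < 1 by rewrite gt_min; apply/orP; right; lra.
    rewrite add0e; apply: (@le_trans _ _ h%:E); last by rewrite lee_fin ge_min lexx.
    rewrite -(Ps h) ?h0//; apply: le_measure; rewrite ?inE//.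
    by apply: subitvPr; rewrite bnd_simp (le_trans s0) ?ltW.
  have [s1|s1] := ltP s 1; first by rewrite Ps ?s0// std_prob_ray// !ltW.
  transitivity (1%E : \bar R).
    apply/eqP; rewrite eq_le probability_le1//=; apply/lee_addgt0Pr => e e0.
    pose h := Num.min e (1 / 2).
    have h0 : 0 < h by rewrite lt_min e0 divr_gt0.
    have h1 : h < 1 by rewrite gt_min; apply/orP; right; lra.
    apply: (@le_trans _ _ ((1 - h)%:E + e%:E)%E).
      rewrite -EFinD lee_fin -addrA lerDl addrC subr_ge0.
      by rewrite ge_min lexx.
    rewrite leeD2r// -(Ps (1 - h)); last by apply/andP; split; lra.
    apply: le_measure; rewrite ?inE//.
    by apply: subitvPr; rewrite bnd_simp; lra.
  apply/esym/eqP; rewrite eq_le probability_le1//= -[leLHS](@std_prob_ray R 1).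
    by apply: le_measure; rewrite ?inE//; apply: subitvPr; rewrite bnd_simp.
  by rewrite ler01 lexx.
have Poray s : P `]s, +oo[%classic = std_prob R `]s, +oo[%classic.
  by rewrite -setCitvl !probability_setC// Pray.
apply: (@measure_unique _ R (measurableTypeR R) (@RGenOInfty.G R)
  (fun n => `](- n%:R)%R, +oo[%classic) _ _ _ _ P (std_prob R)).
- exact: RGenOInfty.measurableE.
- move=> _ _ [x ->] [y ->]; exists (Num.max x y).
  by apply/seteqP; split=> z /=; rewrite !in_itv/= !andbT gt_max => /andP.
- by move=> n; exists (- n%:R).
- apply/seteqP; split=> // x _; exists (Num.bound `|x|) => //=.
  by rewrite in_itv/= andbT ltrNl (le_lt_trans (ler_norm _))// normrN archi_boundP.
- by move=> _ [x ->]; exact: Poray.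
- by move=> n; rewrite (le_lt_trans (probability_le1 _ _))// ltry.
Qed.

Lemma countable_surj (T : Type) (S : set T) : countable S -> S !=set0 ->
  exists c : nat -> T, range c = S.
Proof.
move=> /pfcard_geP[->|[f]]; first by case.
move=> _; exists f; apply/seteqP; split=> [_ [n _ <-]|x Sx]; first exact: funS.
by have [n _ <-] := @surj _ _ _ _ f x Sx; exists n.
Qed.

Section almost_everywhere_facts.
Context d (T : measurableType d) (R : realType) (mu : {measure set T -> \bar R}).

Lemma measure_le_ae (A B : set T) : measurable A -> measurable B ->
  {ae mu, forall x, A x -> B x} -> (mu A <= mu B)%E.
Proof.
move=> mA mB [N [mN N0 ABN]].
apply: (@le_trans _ _ (mu (B `|` N))).
  apply: le_measure; rewrite ?inE//; first exact: measurableU.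
  move=> x Ax; have [Bx|nBx] := pselect (B x); [by left|right].
  by apply: ABN => /(_ Ax).
have {}N0 : (mu N <= 0)%E by rewrite N0.
apply: le_trans (measureU2 _ _ _) _ => //.
by rewrite -[leRHS]adde0; apply: leeD.
Qed.

Lemma measure_eq_ae (A B : set T) : measurable A -> measurable B ->
  {ae mu, forall x, A x <-> B x} -> mu A = mu B.
Proof.
move=> mA mB AB; apply/eqP; rewrite eq_le; apply/andP; split.
  by apply: measure_le_ae => //; apply: filterS AB => x [].
by apply: measure_le_ae => //; apply: filterS AB => x [].
Qed.

Lemma nondecreasing_measure_le (F : nat -> set T) (c : \bar R) :
  nondecreasing_seq F -> (forall n, measurable (F n)) ->
  (forall n, mu (F n) <= c)%E -> (mu (\bigcup_n F n) <= c)%E.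
Proof.
move=> ndF mF Fc.
have cF : mu (F n) @[n --> \oo] --> mu (\bigcup_n F n).
  by apply: nondecreasing_cvg_mu => //; exact: bigcupT_measurable.
rewrite -(cvg_lim _ cF)//; apply: lime_le; first by apply/cvg_ex; eexists; exact: cF.
by near=> n; exact: Fc.
Unshelve. all: by end_near. Qed.

End almost_everywhere_facts.

(** * Uniformization by the distribution function *)

Section uniformization.
Context d (T : measurableType d) (R : realType) (P : probability T R).
Context (X : T -> R) (mX : measurable_fun setT X).
Hypothesis X0 : forall t, P (X @^-1` [set t]) = 0%E.
Hypothesis X02 : forall x, 0 <= X x <= 2.

Let mpre (B : set R) : measurable B -> measurable (X @^-1` B).
Proof. by move=> mB; rewrite -[X in measurable X]setTI; exact: mX. Qed.

Let V (t : R) : R := fine (P (X @^-1` `]-oo, t]%classic)).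

Let VE t : (V t)%:E = P (X @^-1` `]-oo, t]%classic).
Proof. by rewrite fineK// fin_num_measure//; exact: mpre. Qed.

Let ndV : {homo V : s t / s <= t}.
Proof.
move=> s t st; rewrite -lee_fin !VE; apply: le_measure; rewrite ?inE.
- exact: mpre.
- exact: mpre.
- by apply: preimage_subset; apply: subitvPr; rewrite bnd_simp.
Qed.

Let mV : measurable_fun [set: R] V.
Proof. exact: nondecreasing_measurable. Qed.

(** The distribution function [V] has no jumps because [X] has no atoms. *)
Let V_lt t : (V t)%:E = P (X @^-1` `]-oo, t[%classic).
Proof.
rewrite VE; apply/eqP; rewrite eq_le; apply/andP; split; last first.
  apply: le_measure; rewrite ?inE; [exact: mpre..|].
  by apply: preimage_subset; apply: subitvPr; rewrite bnd_simp.
rewrite -[leRHS]adde0 -(X0 t); apply: le_trans (measureU2 _ _ _); last 2 first.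
- exact: mpre.
- exact: mpre.
apply: le_measure; rewrite ?inE; first exact: mpre.
  by apply: measurableU; exact: mpre.
move=> x; rewrite /= !in_itv/= le_eqVlt => /predU1P[->|]; [by right|by left].
Qed.

(** At [u = sup E], monotone limits from both sides give [V u = s]. The event [V (X x) <= s] lies
    between [X x < u] and [X x <= u], which have the same measure. *)
Let V_uniform s : 0 < s < 1 -> P ((V \o X) @^-1` `]-oo, s]%classic) = s%:E.
Proof.
move=> /andP[s0 s1]; pose E := [set t | V t <= s].
have Em1 : E (- 1).
  rewrite /E/=; apply: le_trans (ltW s0); rewrite -lee_fin VE.
  rewrite (_ : _ @^-1` _ = set0) ?measure0//; apply/seteqP; split=> // x /=.
  by rewrite in_itv/=; have /andP[] := X02 x; lra.
have E2 : ubound E 2.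
  move=> t /= Vt; rewrite leNgt; apply/negP => t2; move: s1; apply/negP.
  rewrite -leNgt (le_trans _ Vt)// -lee_fin VE -(@probability_setT _ _ _ P).
  apply: le_measure; rewrite ?inE//; first exact: mpre.
  by move=> x _ /=; rewrite in_itv/=; have /andP[] := X02 x; lra.
have hE : has_sup E by split; [exists (- 1)|exists 2].
pose u := sup E.
have ltu t : t < u -> V t <= s.
  move=> /(sup_gt hE.1)[v Ev tv]; apply: le_trans Ev.
  by apply: ndV; exact: ltW.
have gtu t : u < t -> s < V t.
  by move=> ut; rewrite ltNge; apply/negP => /(ub_le_sup hE.2); rewrite leNgt ut.
have itv_n n : 0 < n.+1%:R^-1 :> R by rewrite invr_gt0.
have Vu_le : V u <= s.
  rewrite -lee_fin V_lt.
  have -> : X @^-1` `]-oo, u[%classic =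
      \bigcup_n (X @^-1` `]-oo, u - n.+1%:R^-1]%classic).
    apply/seteqP; split=> x /=.
      rewrite in_itv/= -subr_gt0 => /ltr_add_invr[n]; rewrite add0r => Xn.
      by exists n => //=; rewrite in_itv/= lerBrDr -lerBrDl ltW.
    by move=> [n _ /=]; rewrite !in_itv/=; move: (itv_n n); move: _^-1 => c; lra.
  apply: nondecreasing_measure_le.
  - move=> m n mn; apply/subsetPset => x /=; rewrite !in_itv/= => h.
    by apply: le_trans h _; rewrite lerD2l lerN2 lef_pV2 ?posrE// ler_nat.
  - by move=> n; exact: mpre.
  - move=> n; have : V (u - n.+1%:R^-1) <= s.
      by apply: ltu; move: (itv_n n); move: _^-1 => c; lra.
    by rewrite -lee_fin VE.
have Vu_ge : s <= V u.
  suff : 1 - V u <= 1 - s by lra.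
  rewrite -lee_fin EFinB VE.
  rewrite -probability_setC; last exact: mpre.
  have -> : ~` (X @^-1` `]-oo, u]%classic) =
      \bigcup_n (X @^-1` `]u + n.+1%:R^-1, +oo[%classic).
    rewrite preimage_setC setCitvl; apply/seteqP; split=> x /=.
      rewrite in_itv/= andbT => /ltr_add_invr[n Xn].
      by exists n => //=; rewrite in_itv/= andbT.
    by move=> [n _ /=]; rewrite !in_itv/= !andbT; move: (itv_n n); move: _^-1 => c; lra.
  apply: nondecreasing_measure_le.
  - move=> m n mn; apply/subsetPset => x /=; rewrite !in_itv/= !andbT => h.
    by apply: le_lt_trans h; rewrite lerD2l lef_pV2 ?posrE// ler_nat.
  - by move=> n; exact: mpre.
  - move=> n; have : s <= V (u + n.+1%:R^-1).
      by apply/ltW/gtu; move: (itv_n n); move: _^-1 => c; lra.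
    rewrite -setCitvl -preimage_setC => sV.
    have : 1 - V (u + n.+1%:R^-1) <= 1 - s by rewrite lerB.
    by rewrite -lee_fin EFinB VE -probability_setC//; exact: mpre.
have Vu : V u = s by apply/eqP; rewrite eq_le Vu_le.
have mVX : measurable ((V \o X) @^-1` `]-oo, s]%classic).
  rewrite comp_preimage; apply: mpre; rewrite -[X in measurable X]setTI.
  exact: mV.
have le_Vu : (P ((V \o X) @^-1` `]-oo, s]%classic) <= (V u)%:E)%E.
  rewrite VE; apply: le_measure; rewrite ?inE//; first exact: mpre.
  by move=> x /=; rewrite !in_itv/= => VXs; rewrite leNgt; apply/negP => /gtu; rewrite ltNge VXs.
have ge_Vu : ((V u)%:E <= P ((V \o X) @^-1` `]-oo, s]%classic))%E.
  rewrite V_lt; apply: le_measure; rewrite ?inE//; first exact: mpre.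
  by move=> x /=; rewrite !in_itv/= => /ltu.
by rewrite -[RHS](congr1 EFin Vu); apply/eqP; rewrite eq_le le_Vu.
Qed.

Let V_std (B : set (measurableTypeR R)) : measurable B ->
  P ((V \o X) @^-1` B) = std_prob R B.
Proof.
have mVX : @measurable_fun _ _ T (measurableTypeR R) [set: T] (V \o X).
  exact: measurableT_comp.
pose Y : {mfun T >-> measurableTypeR R} :=
  @mfun_Sub _ _ T (measurableTypeR R) _ (mem_set mVX).
by move=> mB; exact: (@std_prob_unique R (distribution P Y) V_uniform B).
Qed.

(** The quantile function, a generalized inverse of [V]. The point 0 keeps the set nonempty, so that
    [sup] never takes its default value. *)
Let Q (s : R) : R := sup [set t | 0 <= t <= 2 /\ (t = 0 \/ V t < s)].

Let Q_has_sup s : has_sup [set t | 0 <= t <= 2 /\ (t = 0 \/ V t < s)].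
Proof.
split; first by exists 0; split; [lra|left].
by exists 2 => t [/andP[]].
Qed.

Let mQ : measurable_fun [set: R] Q.
Proof.
apply: nondecreasing_measurable => // s t st.
apply: le_sup; [|exact: (Q_has_sup s).1|exact: Q_has_sup].
move=> u [u02 us]; apply/downP; exists u => //; split=> //.
by case: us => [->|us]; [left|right; exact: lt_le_trans st].
Qed.

(* [V] maps [X] to a uniform variable, so each of its level sets is null; off
   the level sets of its rational values [V] is injective. *)
Lemma uniformize : exists V Q : R -> R,
  [/\ measurable_fun [set: R] V, measurable_fun [set: R] Q,
      forall B : set (measurableTypeR R), measurable B ->
        P ((V \o X) @^-1` B) = std_prob R B &
      {ae P, forall x, Q (V (X x)) = X x}].
Proof.
exists V, Q; split=> //.
(* Enumerates the rationals; 0 stands in for numbers that code none. *)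
pose q n : R := ratr (odflt 0 (@choice.unpickle rat n)).
have : {ae P, forall x, forall n, V (X x) <> V (q n)}.
  apply: ae_foralln => n; exists ((V \o X) @^-1` [set V (q n)]); split.
  - rewrite -[X in measurable X]setTI.
    by apply: (measurableT_comp mV mX).
  - exact: etrans (V_std (measurable_set1 _)) (std_prob_set1 _).
  - by move=> x /=; rewrite notK.
move=> aeV; apply: (@filterS _ _ (ae_filter_ringOfSetsType P) _ _ _ aeV) => x Vx.
have /andP[x0 x2] := X02 x.
have [hn hb] := Q_has_sup (V (X x)).
apply/eqP; rewrite eq_le; apply/andP; split.
  apply: ge_sup => // t [_ [->//|Vt]].
  by rewrite leNgt; apply/negP => /ltW/ndV; rewrite leNgt Vt.
(* A rational [w] between [Q (V (X x))] and [X x] satisfies [V w < V (X x)], as equality is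
   excluded; so [w] competes in the supremum and is at most [Q (V (X x))]. *)
rewrite leNgt; apply/negP => QX.
have [w] := rat_in_itvoo QX; rewrite in_itv/= => /andP[Qw wX].
move: (Qw); apply/negP; rewrite -leNgt.
have Q0 : 0 <= Q (V (X x)).
  by apply: ub_le_sup => //; split; [lra|left].
apply: ub_le_sup => //; split; first by apply/andP; split; lra.
right; rewrite lt_neqAle ndV ?ltW// andbT; apply/eqP => Vw.
by apply: (Vx (choice.pickle w)); rewrite /q choice.pickleK.
Qed.

End uniformization.

(** * Standard models of diffuse actions *)

Section regularization.
Context (G : groupType) (R : realType) (cG : countable [set: G]).
Context (a : pmp_action G R).

Let mu := pmp_prob a.

Let groupT0 : [set: G] !=set0. Proof. by exists 1%g. Qed.

Lemma ae_forall_group (Q : G -> pmp_space a -> Prop) :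
  (forall g, {ae mu, forall x, Q g x}) -> {ae mu, forall x, forall g, Q g x}.
Proof.
move=> aeQ; have [c cT] := countable_surj cG groupT0.
have : {ae mu, forall x, forall n, Q (c n) x} by apply: ae_foralln.
move=> aeQc; apply: (@filterS _ _ (ae_filter_ringOfSetsType mu) _ _ _ aeQc) => x Qx g.
by have [n _ <-] : range c g by rewrite cT.
Qed.

Lemma ae_act (Q : pmp_space a -> Prop) (g : G) :
  {ae mu, forall x, Q x} -> {ae mu, forall x, Q (act g x)}.
Proof.
move=> [N [mN N0 QN]]; exists (act g @^-1` N); split.
- exact: measurable_act_preimage.
- by rewrite -N0; exact: act_fun_preserving.
- by move=> x /= nQ; apply: QN.
Qed.

Context (p : pmp_space a -> measurableTypeR R) (mp : measurable_fun setT p).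
Hypothesis pE : forall B, measurable B -> mu (p @^-1` B) = std_prob R B.
Context (T : G -> measurableTypeR R -> measurableTypeR R).
Hypothesis mT : forall g, measurable_fun setT (T g).
Hypothesis pT : forall g, {ae mu, forall x, p (act g x) = T g (p x)}.

(* The action laws for [T] only hold almost everywhere; the points at which
   they hold form an invariant set, off which the new action is trivial. *)
Let good (t : R) := T 1%g t = t /\ forall g h, T g (T h t) = T (g * h)%g t.

Let good_stable k t : good t -> good (T k t).
Proof.
move=> [t1 tM]; split; first by rewrite tM mul1g.
by move=> g h; rewrite !tM mulgA.
Qed.

Let eq_measurable (f g : measurableTypeR R -> measurableTypeR R) :
  measurable_fun setT f -> measurable_fun setT g ->
  measurable [set t | f t = g t].
Proof.
move=> mf mg; rewrite (_ : [set t | _] = (fun t => f t == g t) @^-1` [set true]).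
  rewrite -[X in measurable X]setTI.
  by apply: measurable_fun_eqr.
by apply/seteqP; split => t /= /eqP.
Qed.

Let measurable_good : measurable [set t | good t].
Proof.
have [c cT] := countable_surj cG groupT0.
rewrite (_ : [set t | _] = [set t | T 1%g t = t] `&`
  \bigcap_m \bigcap_n [set t | T (c m) (T (c n) t) = T (c m * c n)%g t]).
  apply: measurableI; first exact: eq_measurable.
  apply: bigcapT_measurable => m; apply: bigcapT_measurable => n.
  by apply: eq_measurable => //; exact: measurableT_comp.
apply/seteqP; split=> t /= [t1 tM]; split=> //.
  by move=> m _ n _; exact: tM.
move=> g h; have [m _ <-] : range c g by rewrite cT.
have [n _ <-] : range c h by rewrite cT.
exact: tM.
Qed.

(** The laws hold exactly for [a], and [p] transports each of them to [T] almost everywhere;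
    countability of [G] handles all of them at once. *)
Let good_ae : {ae mu, forall x, good (p x)}.
Proof.
have law : {ae mu, forall x, forall g h,
    T g (T h (p x)) = T (g * h)%g (p x)}.
  apply: ae_forall_group => g; apply: ae_forall_group => h.
  have F := ae_filter_ringOfSetsType mu.
  apply: (@filterS3 _ _ F _ _ _ _ _ (pT h) (ae_act h (pT g)) (pT (g * h)%g)).
  by move=> x <- <- <-; rewrite {3}/act act_funM.
apply: (@filterS2 _ _ (ae_filter_ringOfSetsType mu) _ _ _ _ law (pT 1%g)) => x xM x1.
by split=> //; rewrite -x1 /act act_fun1.
Qed.

Let S (g : G) (t : measurableTypeR R) : measurableTypeR R :=
  if `[< good t >] then T g t else t.

Let S1 t : S 1%g t = t.
Proof. by rewrite /S; case: ifPn => // /asboolP[]. Qed.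

Let SM g h t : S (g * h)%g t = S g (S h t).
Proof.
rewrite /S; have [/asboolP gt|ngt] := boolP `[< good t >]; last first.
  by rewrite (negbTE ngt).
by rewrite (asboolT (good_stable h gt)) (proj2 gt).
Qed.

Let mS g : measurable_fun setT (S g).
Proof.
apply: measurable_fun_ifT => //; apply: (measurable_fun_bool true).
rewrite setTI (_ : _ @^-1` _ = [set t | good t]).
  exact: measurable_good.
by apply/seteqP; split=> t /= /asboolP.
Qed.

Let pS g : {ae mu, forall x, p (act g x) = S g (p x)}.
Proof.
apply: (@filterS2 _ _ (ae_filter_ringOfSetsType mu) _ _ _ _ good_ae (pT g)).
by move=> x gx ->; rewrite /S asboolT.
Qed.

Let S_preserving g (A : set (measurableTypeR R)) : measurable A ->
  std_prob R (S g @^-1` A) = std_prob R A.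
Proof.
move=> mA.
have mpre (B : set (measurableTypeR R)) : measurable B -> measurable (p @^-1` B).
  by move=> mB; rewrite -[X in measurable X]setTI; exact: mp.
have mSA : measurable (S g @^-1` A).
  by rewrite -[X in measurable X]setTI; exact: mS.
rewrite -!pE// -[RHS](act_fun_preserving (pmp_act_on a) g); last exact: mpre.
apply: measure_eq_ae; first exact: mpre.
  by apply: measurable_act_preimage; exact: mpre.
apply: (@filterS _ _ (ae_filter_ringOfSetsType mu) _ _ _ (pS g)) => x.
by rewrite /= -/(act g x) => ->.
Qed.

Lemma regularize : exists s : pmp_on G (std_prob R),
  forall g, {ae mu, forall x, p (act g x) = act_fun s g (p x)}.
Proof. by exists (PmpOn S1 SM mS S_preserving); exact: pS. Qed.

End regularization.

Lemma measurable_membership_class d (T : measurableType d) (E : nat -> set T)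
    (y : T) : (forall m, measurable (E m)) ->
  measurable [set x | forall m, E m x <-> E m y].
Proof.
move=> mE.
rewrite (_ : [set x | _] = \bigcap_m [set x | E m x <-> E m y]); last first.
  by apply/seteqP; split=> x /= h m; [move=> _; exact: h|exact: h].
apply: bigcapT_measurable => m; have [Ey|nEy] := pselect (E m y).
  by rewrite (_ : [set x | _] = E m)//; apply/seteqP; split=> x /=; tauto.
by rewrite (_ : [set x | _] = ~` E m); [exact: measurableC|];
  apply/seteqP; split=> x /=; tauto.
Qed.

Section std_factors.
Context (G : groupType) (R : realType) (cG : countable [set: G]).
Context (a : pmp_action G R).

Let mu := pmp_prob a.

(** The code of [x] records, for all [g] and [m], whether [g x] lies in [E m]. Its fibres lie in
    membership classes, which are null, so [uniformize] applies: the factor map is [V] of the code,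
    and [D m] reads membership in [E m] back through [Q]. *)
Lemma std_factor (E : nat -> set (pmp_space a)) :
  (forall m, measurable (E m)) ->
  (forall y, mu [set x | forall m, E m x <-> E m y] = 0%E) ->
  exists (s : pmp_on G (std_prob R)) (p : pmp_space a -> measurableTypeR R)
      (D : nat -> set (measurableTypeR R)),
    [/\ measurable_fun setT p,
        forall B, measurable B -> mu (p @^-1` B) = std_prob R B,
        forall g, {ae mu, forall x, p (act g x) = act_fun s g (p x)},
        forall m, measurable (D m) &
        {ae mu, forall x, forall m, E m x <-> D m (p x)}].
Proof.
move=> mE E0.
have cGN : countable ([set: G] `*` [set: nat]) by exact: countableX.
have [c cT] := countable_surj cGN (ex_intro _ (1%g, 0%N) (conj I I)).
have /choice[c' c'K] y : exists n, c n = y.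
  have : range c y by rewrite cT; split.
  by move=> [n _ <-]; exists n.
pose bits x n : bool := `[< E (c n).2 (act (c n).1 x) >].
have mbits n : measurable [set x | bits x n].
  rewrite (_ : [set x | _] = act (c n).1 @^-1` E (c n).2).
    exact: measurable_act_preimage.
  by apply/seteqP; split=> x /= /asboolP.
pose X x : R := tern (bits x).
have mX : measurable_fun setT X by exact: (measurable_tern (c := fun n x => bits x n)).
have bitsE x m : bits x (c' (1%g, m)) <-> E m x.
  by rewrite /bits c'K /= /act act_fun1; split=> /asboolP.
have X0 t : mu (X @^-1` [set t]) = 0%E.
  have [[y yt]|nt] := pselect (exists y, X y = t); last first.
    rewrite (_ : _ @^-1` _ = set0) ?measure0//.
    by apply/seteqP; split=> // x /= xt; apply: nt; exists x.
  apply/eqP; rewrite eq_le measure_ge0 andbT -(E0 y).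
  apply: le_measure; rewrite ?inE.
  - by rewrite -[X in measurable X]setTI; exact: mX.
  - exact: measurable_membership_class.
  - move=> x /= xt m; rewrite -!bitsE.
    by rewrite -(tern_digitE (R := R) _ (bits x)) -(tern_digitE (R := R) _ (bits y))
      -/(X x) -/(X y) xt yt.
have X02 x : 0 <= X x <= 2.
  by apply/andP; split; [exact: tern_ge0|apply: le_trans (tern_le _) _; lra].
have [V [Q [mV mQ VX QVX]]] := uniformize mX X0 X02.
(* Acting by [h] reindexes the digits: digit [(g, m)] of the code of [h x] is digit [(g h, m)] of
   the code of [x]. *)
pose T' h (t : R) : R :=
  tern (fun n => tern_digit (c' (((c n).1 * h)%g, (c n).2)) t).
have XT' h x : X (act h x) = T' h (X x).
  congr tern; apply/funext => n; rewrite tern_digitE /bits c'K/=.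
  by rewrite /act act_funM.
have mT' h : measurable_fun setT (T' h).
  by apply: measurable_tern => n; exact: measurable_tern_digit.
have mp : measurable_fun setT (V \o X) by exact: measurableT_comp.
have [|g|s sP] := @regularize G R cG a (V \o X) mp VX (fun g => V \o (T' g \o Q)).
- by move=> g; apply: measurableT_comp => //; exact: measurableT_comp.
- apply: (@filterS _ _ (ae_filter_ringOfSetsType mu) _ _ _ QVX) => x /= ->.
  by rewrite XT'.
exists s, (V \o X), (fun m => [set t | tern_digit (c' (1%g, m)) (Q t)]); split=> //.
- move=> m; rewrite (_ : [set t | _] =
    Q @^-1` [set t | tern_digit (c' (1%g, m)) t])//.
  rewrite -[X in measurable X]setTI; apply: mQ => //.
  exact: measurable_tern_digit.
- apply: (@filterS _ _ (ae_filter_ringOfSetsType mu) _ _ _ QVX) => x /= -> m.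
  by rewrite tern_digitE bitsE.
Qed.

End std_factors.

Section factor_containment.
Context (G : groupType) (R : realType).
Implicit Types (a b : pmp_action G R).

(** Pulling partitions back along a factor map preserves statistics; hence a factor is weakly
    contained in its extension. *)
Lemma part_dist_factor a b (p : pmp_space a -> pmp_space b) :
  measurable_fun setT p ->
  (forall B, measurable B -> pmp_prob a (p @^-1` B) = pmp_prob b B) ->
  (forall g, {ae pmp_prob a, forall x, p (act g x) = act g (p x)}) ->
  forall F k (B : 'I_k -> set (pmp_space b)), Part k b B ->
    Part k a (fun i => p @^-1` B i) /\
    part_dist F (fun i => p @^-1` B i) B = 0.
Proof.
move=> mp pE pg F k B [mB tB cB].
have mpre C : measurable C -> measurable (p @^-1` C).
  by move=> mC; rewrite -[X in measurable X]setTI; exact: mp.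
split; first split.
- by move=> i; exact: mpre.
- by move=> i j _ _ [x [Bi Bj]]; apply: (tB i j I I); exists (p x).
- apply/seteqP; split=> // x _.
  have [i _ Bi] : (\bigcup_i B i) (p x) by rewrite cB.
  by exists i.
rewrite /part_dist big1// => i _; rewrite big1// => j _; rewrite big1// => f _.
apply/eqP; rewrite normr_eq0 subr_eq0; apply/eqP; congr fine.
rewrite !act_image -pE; last first.
  by apply: measurableI => //; exact: measurable_act_preimage.
apply: measure_eq_ae.
- by apply: measurableI; [exact: mpre|apply: measurable_act_preimage; exact: mpre].
- by apply: mpre; apply: measurableI => //; exact: measurable_act_preimage.
apply: (@filterS _ _ (ae_filter_ringOfSetsType (pmp_prob a)) _ _ _ (pg (f^-1)%g)).
by move=> x /= ->.
Qed.

End factor_containment.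

Section std_models.
Context (G : groupType) (R : realType) (cG : countable [set: G]).
Context (a : pmp_action G R).

Let mu := pmp_prob a.

Lemma Part_countable_net F k (e : R) : 0 < e ->
  exists M : set (set (pmp_space a)),
    [/\ countable M, M `<=` measurable &
        forall A, Part k a A -> exists C,
          [/\ Part k a C, forall i, M (C i) & part_dist F A C < e]].
Proof.
move=> e0; have [I [N [pN netN]]] := Part_net F k a e0.
exists (\bigcup_v range (N v)); split.
- by apply: bigcup_countable => // v _; apply: finite_set_countable; exact: finite_image.
- by move=> _ [v _ [i _ <-]]; have [+ _ _] := pN v; apply.
- move=> A pA; have [v Av] := netN A pA; exists (N v); split=> //.
  by move=> i; exists v.
Qed.

(** Diffuseness is expressed by countable covers by small sets. These make the membership classes
    null in [std_factor]; adding countably many nets of partitions to the family makes the factor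
    retain all statistics of [a] up to any error. *)
Lemma std_model :
  (forall e : R, 0 < e -> exists S : set (set (pmp_space a)),
    [/\ countable S, S `<=` measurable &
        forall x, exists A, [/\ S A, A x & (mu A <= e%:E)%E]]) ->
  exists s : pmp_on G (std_prob R), weakly_equivalent (PmpAction s) a.
Proof.
move=> diffuse.
have inv0 n : 0 < n.+1%:R^-1 :> R by rewrite invr_gt0.
have /choice[S SP] n := diffuse _ (inv0 n).
have [cg cgT] := countable_surj cG (ex_intro _ 1%g I).
(* Finite subsets of [G] are coded by finite sets of indices of [cg], which keeps the family [W]
   countable. *)
have /choice[M MP] (u : {fset nat} * nat * nat) :=
  Part_countable_net [fset cg i | i in u.1.1]%fset u.1.2 (inv0 u.2).
pose W := \bigcup_(o : nat + {fset nat} * nat * nat)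
  (match o with inl n => S n | inr u => M u end).
have cW : countable W.
  by apply: bigcup_countable => // -[n|u] _; [case: (SP n)|case: (MP u)].
have W0 : W !=set0.
  have [_ _ /(_ point)[A [SA _ _]]] := SP 0%N.
  by exists A, (inl 0%N).
have [E EW] := countable_surj cW W0.
have mE m : measurable (E m).
  have : W (E m) by rewrite -EW; exists m.
  move=> [[n|u] _]; first by have [_ + _] := SP n; apply.
  by have [_ + _] := MP u; apply.
have E0 y : mu [set x | forall m, E m x <-> E m y] = 0%E.
  apply/eqP; rewrite eq_le measure_ge0 andbT; apply/lee_addgt0Pr => e e0.
  rewrite add0e; have [n] := ltr_add_invr e0; rewrite add0r => ne.
  have [_ mS /(_ y)[A [SA Ay Ale]]] := SP n.
  have [m _ EmA] : range E A by rewrite EW; exists (inl n).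
  apply: le_trans (le_trans Ale _); last by rewrite lee_fin ltW.
  apply: le_measure; rewrite ?inE; last first.
  - by move=> x /(_ m); rewrite EmA => -[_]; apply.
  - exact: mS.
  exact: measurable_membership_class.
have [s [p [D [mp pE pg mD ED]]]] := std_factor cG mE E0.
exists s; split=> F k; apply/eqP; rewrite eq_le dweak_ge0 andbT.
  apply: dweak_lub => // B pB.
  have [pA AB] := @part_dist_factor G R a (PmpAction s) p mp pE pg F k B pB.
  by rewrite -AB part_distC; exact: dpart_le.
apply: dweak_lub => // A pA; apply/ler_addgt0Pr => e e0; rewrite add0r.
have k0 : (0 < k)%N.
  have [_ _ cA] := pA; have : [set: pmp_space a] point by [].
  by rewrite -cA => -[i _ _]; exact: leq_ltn_trans (ltn_ord i).
have [n] := ltr_add_invr e0; rewrite add0r => ne.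
have /choice[cg' cg'K] g : exists i, cg i = g.
  have : range cg g by rewrite cgT.
  by move=> [i _ <-]; exists i.
pose u := ([fset cg' g | g in F]%fset, k, n).
have uF : [fset cg i | i in u.1.1]%fset = F.
  apply/fsetP => g; apply/imfsetP/idP => /= [[i /imfsetP[/= h hF ->] ->]|gF].
    by rewrite cg'K.
  by exists (cg' g); rewrite ?cg'K//; apply/imfsetP; exists g.
have [_ _ /(_ A pA)] := MP u; rewrite uF => -[C [pC MC AC]].
have /choice[m EC] i : exists m, E m = C i.
  have : range E (C i) by rewrite EW; exists (inr u) => //; exact: MC.
  by move=> [j _ <-]; exists j.
pose b := PmpAction s.
(* The sets [D (m i)] form a partition only up to a null set; [mkpart] repairs this without changing
   the statistics. *)
pose B : 'I_k -> set (pmp_space b) := mkpart (fun i => D (m i)).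
have pB : Part k b B by exact: Part_mkpart.
have [pBa Ba0] := @part_dist_factor G R a b p mp pE pg F k B pB.
have CB : part_dist F C (fun i => p @^-1` B i) <= 0.
  have [N [mN N0 EDN]] := ED.
  rewrite (_ : 0 = part_bound F k * (0 *+ 2)); last by rewrite mul0rn mulr0.
  apply: (part_dist_perturb _ pC pBa mN); first by rewrite N0.
  move=> i x Ci; have [Nx|nNx] := pselect (N x); [by right|left].
  have EDx : forall j, E j x <-> D j (p x).
    by apply: contrapT => h; apply: nNx; exact: EDN.
  apply: mkpart_uniq; first by apply/EDx; rewrite EC.
  move=> j /EDx; rewrite EC => Cj; have [_ tC _] := pC.
  by apply: (tC _ _ I I); exists x.
apply: le_trans (dpart_le _ _ pB) _.
apply: le_trans (part_dist_triangle _ _ C _) _.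
rewrite -[e]addr0 lerD//; first by rewrite ltW// (lt_trans AC).
by rewrite (le_trans (part_dist_triangle _ _ (fun i => p @^-1` B i) _))// Ba0 addr0.
Qed.

End std_models.

(** * Standard models of ultraproducts *)

Section finite_space.
Context (R : realType) (N : nat).

Lemma fin_probE (A : set (fin_space N)) :
  fin_prob R N A = (#|[pred x : 'I_N.+1 | `[< A x >]]|%:R / N.+1%:R)%:E.
Proof.
have countE (B : set (fin_space N)) :
    counting B = (#|[pred x : 'I_N.+1 | `[< B x >]]|%:R : R)%:E.
  have BE : B = [set` [fset x in [pred x : 'I_N.+1 | `[< B x >]]]%fset].
    apply/seteqP; split=> x /= => [Bx|/imfsetP[y /= + ->]].
      by apply/imfsetP; exists x => //=; rewrite inE.
    by rewrite inE.
  rewrite {1}BE /counting asboolT; last exact: finite_fset.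
  by rewrite set_fsetK card_imfset//= -cardE.
pose c := @counting (fin_space N) R.
(* This is [mnormalize] unfolded; the default branch is excluded because the total mass [N + 1] is
   neither 0 nor infinite. *)
transitivity ((if (c setT == 0) || (c setT == +oo)
  then fun B => \d_(point : fin_space N) B
  else fun B => c B * (fine (c setT))^-1%:E) A)%E; first by [].
rewrite /c !countE.
have -> : #|[pred x : 'I_N.+1 | `[< [set: fin_space N] x >]]| = N.+1.
  by rewrite -[RHS]card_ord; apply: eq_card => x; rewrite !inE asboolT.
by rewrite eqe pnatr_eq0/= countE EFinM.
Qed.

(** Division by [M] is injective on a residue class, and its values on [0, ..., N] are at most
    [N %/ M]. *)
Lemma card_modn_le (M j : nat) : (0 < M)%N ->
  (#|[pred x : 'I_N.+1 | (x %% M)%N == j]| <= (N %/ M).+1)%N.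
Proof.
move=> M0.
pose f (x : 'I_N.+1) : 'I_(N %/ M).+1 := inord (x %/ M).
have quo_lt (x : 'I_N.+1) : (x %/ M < (N %/ M).+1)%N.
  by rewrite ltnS leq_div2r// -ltnS.
rewrite -[leqRHS]card_ord; apply: (@leq_card_in _ _ f) => x y.
rewrite !inE => /eqP xj /eqP yj /(congr1 val)/=.
rewrite !inordK ?quo_lt// => xy; apply: val_inj => /=.
by rewrite (divn_eq x M) (divn_eq y M) xj yj xy.
Qed.

End finite_space.

Section small_pieces.
Context (G : groupType) (R : realType).

(** A residue class modulo [m + 1] has at most [N %/ (m + 1) + 1] of the [N + 1] points; as
    [m <= N], its proportion is at most [2 / (m + 1)]. *)
Lemma FinAct_small_pieces N (s : pmp_on G (fin_prob R N)) m : (m <= N)%N ->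
  exists C : 'I_m.+1 -> set (pmp_space (FinAct s)),
    Part m.+1 (FinAct s) C /\
    forall i, (pmp_prob (FinAct s) (C i) <= (2 / m.+1%:R)%:E)%E.
Proof.
move=> mN; exists (fun i => [set x : 'I_N.+1 | (x %% m.+1)%N = i]).
split; first split.
- by [].
- by move=> i j _ _ [x [/= xi xj]]; apply: val_inj; rewrite /= -xi -xj.
- apply/seteqP; split=> // x _.
  by exists (Ordinal (ltn_pmod (x : 'I_N.+1) (ltn0Sn m))).
move=> i; rewrite [leLHS]fin_probE lee_fin.
rewrite ler_pdivrMr ?ltr0n// mulrAC ler_pdivlMr ?ltr0n//.
rewrite -!natrM ler_nat.
have -> : #|[pred x : 'I_N.+1 | `[< (x %% m.+1)%N = i >]]| =
    #|[pred x : 'I_N.+1 | (x %% m.+1)%N == i]|.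
  by apply: eq_card => x; rewrite !inE; apply/asboolP/eqP.
apply: (@leq_trans ((N %/ m.+1).+1 * m.+1)).
  by rewrite leq_mul2r card_modn_le// orbT.
rewrite mulSn addnC mul2n -addnn leq_add//.
by rewrite (leq_trans (leq_divM _ _))// leqnSn.
Qed.

(** Disjointified rays cut [[0, 1]] into intervals of length [1 / (m + 1)]; the rest of the line is
    null. *)
Lemma StdAct_small_pieces (s : pmp_on G (std_prob R)) m :
  exists C : 'I_m.+1 -> set (pmp_space (StdAct s)),
    Part m.+1 (StdAct s) C /\
    forall i, (pmp_prob (StdAct s) (C i) <= (m.+1%:R^-1)%:E)%E.
Proof.
pose D (i : 'I_m.+1) : set (measurableTypeR R) := `]-oo, i.+1%:R / m.+1%:R]%classic.
have mD i : measurable (D i) by exact: measurable_itv.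
exists (mkpart D); split; first exact: Part_mkpart.
move=> i; have mC : measurable (mkpart D i) by exact: measurable_mkpart.
rewrite [leLHS]std_probE//.
apply: (@le_trans _ _ (@lebesgue_measure R
    `[i%:R / m.+1%:R, i.+1%:R / m.+1%:R]%classic)).
  apply: le_measure; rewrite ?inE//; first exact: measurableI.
  move=> x [[Dx nDx]] /=; rewrite !in_itv/= => /andP[x0 x1].
  apply/andP; split.
    have [i0|i0] := posnP i; first by rewrite i0 mul0r.
    rewrite leNgt; apply/negP => xi; apply: nDx.
    have i1 : (i.-1 < m.+1)%N by rewrite (leq_ltn_trans (leq_pred _)).
    by exists (Ordinal i1); rewrite /= ?ltn_predL// /D/= in_itv/= prednK// ltW.
  case: Dx => [|/= im]; first by rewrite /D/= in_itv.
  by rewrite im divff.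
rewrite lebesgue_measure_itv/=; case: ifP => _; last by rewrite lee_fin invr_ge0.
by rewrite -EFinB -mulrBl -natrB// subSnn mul1r.
Qed.

End small_pieces.

Section model_of_ultraproduct.
Context (G : groupType) (R : realType) (cG : countable [set: G]).
Context (U : nonprincipal_ultrafilter) (r : nat -> Act G R).

Let aU := ultraproduct U (fun n => action_of (r n)).

Let constant_size N :=
  ultra_sets U [set n | exists s : pmp_on G (fin_prob R N), r n = FinAct s].

Lemma dweak_same_act d (T : measurableType d) (nu : probability T R)
    (s t : pmp_on G nu) F k :
  (forall f, f \in F -> act_fun s f = act_fun t f) ->
  dweak F k (PmpAction s) (PmpAction t) = 0.
Proof.
move=> st; apply/eqP; rewrite eq_le dweak_ge0 andbT.
apply: dweak_lub => // A pA.
suff <- : part_dist F A (A : 'I_k -> set (pmp_space (PmpAction t))) = 0.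
  exact: dpart_le.
rewrite /part_dist big1// => i _; rewrite big1// => j _; rewrite big_seq big1//.
by move=> f fF; rewrite /part_stat /act/= st// subrr normr0.
Qed.

Lemma weak_limit_ultraproduct (b : pmp_action G R) :
  (forall F k, \forall n \near ultra_sets U,
    dweak F k b (r n) = 0 /\ dweak F k (r n) b = 0) ->
  weakly_equivalent b aU.
Proof.
move=> rb; split=> F k; apply/eqP; rewrite eq_le dweak_ge0 andbT;
  apply/ler_addgt0Pr => e e0; rewrite add0r.
  have [n [[br _] ru]] := @filter_ex _ (ultra_sets U) _ _ (filterI (rb F k)
    (@dweak_to_ultraproduct G R U (fun n => action_of (r n)) F k e e0)).
  by rewrite (le_trans (dweak_triangle _ _ _ (r n) _))// br add0r ltW.
have [n [[_ rb'] ur]] := @filter_ex _ (ultra_sets U) _ _ (filterI (rb F k)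
  (@dweak_from_ultraproduct G R U (fun n => action_of (r n)) F k e e0)).
by rewrite (le_trans (dweak_triangle _ _ _ (r n) _))// rb' addr0 ltW.
Qed.

(** For fixed [g] and [x] the images of [x] under [g] take finitely many values, so one of them
    occurs for almost all [n] and defines the limit action [L]. Each law, and each finite [F],
    involves finitely many group elements, on which almost all [s n] agree with [L]. *)
Lemma finite_model N : constant_size N ->
  exists s : pmp_on G (fin_prob R N), weakly_equivalent (FinAct s) aU.
Proof.
move=> UN; have [n0 [s0 _]] := filter_ex UN.
have /choice[s sP] n : exists s : pmp_on G (fin_prob R N),
    (exists s' : pmp_on G (fin_prob R N), r n = FinAct s') -> r n = FinAct s.
  have [[s rs]|ns] := pselect (exists s' : pmp_on G (fin_prob R N), r n = FinAct s').
    by exists s.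
  by exists s0.
have Us : ultra_sets U [set n | r n = FinAct (s n)].
  by apply: filterS UN => n; exact: sP.
have limP (gx : G * fin_space N) : exists y : fin_space N,
    ultra_sets U [set n | act_fun (s n) gx.1 gx.2 = y].
  apply: contrapT => /forallNP nU.
  have [n /(_ (act_fun (s n) gx.1 gx.2 : 'I_N.+1))] : exists n,
      forall y : 'I_N.+1, act_fun (s n) gx.1 gx.2 <> y.
    apply: (@filter_ex _ (ultra_sets U)); apply: filter_forall => y.
    exact/ultra_setC/nU.
  exact.
have [L' L'P] := choice limP; pose L g x := L' (g, x).
have LP g : \forall n \near ultra_sets U, act_fun (s n) g = L g.
  suff : \forall n \near ultra_sets U, forall x : 'I_N.+1,
      act_fun (s n) g x = L g x by apply: filterS => n /funext.
  by apply: filter_forall => x; exact: (L'P (g, x)).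
have L1 x : L 1%g x = x.
  have [n <-] := @filter_ex _ (ultra_sets U) _ _ (LP 1%g).
  exact: act_fun1.
have LM g h x : L (g * h)%g x = L g (L h x).
  have [n [<- [<- <-]]] := @filter_ex _ (ultra_sets U) _ _
    (filterI (LP (g * h)%g) (filterI (LP g) (LP h))).
  exact: act_funM.
have mL g : measurable_fun setT (L g) by [].
have Lmu g A : measurable A -> fin_prob R N (L g @^-1` A) = fin_prob R N A.
  have [n <-] := @filter_ex _ (ultra_sets U) _ _ (LP g).
  exact: act_fun_preserving.
pose l := PmpOn L1 LM mL Lmu; exists l.
apply: weak_limit_ultraproduct => F k.
have LF : \forall n \near ultra_sets U, forall f : F,
    act_fun (s n) (val f) = L (val f) by apply: filter_forall.
apply: filterS2 Us LF => n /= -> sL.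
by split; apply: dweak_same_act => f fF; rewrite (sL [` fF]%fset).
Qed.

(** For every [m], almost all [r n] are standard or live on more than [m] points. These have
    partitions into small pieces, whose ultraproduct supplies the small sets for [std_model]. *)
Lemma diffuse_model : (forall N, ~ constant_size N) ->
  exists s : pmp_on G (std_prob R), weakly_equivalent (StdAct s) aU.
Proof.
move=> nU; apply: std_model => // e e0.
have e20 : 0 < e / 2 by rewrite divr_gt0.
have [m] := ltr_add_invr e20; rewrite add0r => me.
pose small n (C : 'I_m.+1 -> set (pmp_space (r n))) :=
  forall i, (pmp_prob (r n) (C i) <= e%:E)%E.
have Cex n : exists C, Part m.+1 (r n) C /\
    ((forall N : 'I_m, ~ exists s : pmp_on G (fin_prob R N), r n = FinAct s) ->
     small n C).
  rewrite /small; case: (r n) => [s|N s].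
    have [C [pC Cm]] := StdAct_small_pieces s m; exists C; split=> // _ i.
    apply: le_trans (Cm i) _; rewrite lee_fin.
    by move: me; move: (m.+1%:R^-1) => c; lra.
  have [mN|Nm] := leqP m N.
    have [C [pC Cm]] := FinAct_small_pieces s mN; exists C; split=> // _ i.
    apply: le_trans (Cm i) _; rewrite lee_fin.
    by move: me; move: (m.+1%:R^-1) => c; lra.
  (* Only finite actions with [N < m] reach this dummy partition; by hypothesis they occur for a
     negligible set of [n]. *)
  exists (mkpart (fun=> set0)); split; first exact: Part_mkpart.
  by move=> /(_ (Ordinal Nm))/=; case; exists s.
pose C n := projT1 (cid (Cex n)).
have pC n : Part m.+1 (r n) (C n) by have [] := projT2 (cid (Cex n)).
have UC : ultra_sets U [set n | small n (C n)].
  have : \forall n \near ultra_sets U, forall N : 'I_m,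
      ~ exists s : pmp_on G (fin_prob R N), r n = FinAct s.
    by apply: filter_forall => N; exact/ultra_setC/nU.
  by apply: filterS => n; have [_] := projT2 (cid (Cex n)).
have [mUC _ cUC] := Part_upart U pC.
exists (range (upart (U := U) C)); split.
- by apply: finite_set_countable; exact: finite_image.
- by move=> _ [i _ <-]; exact: mUC.
- move=> x; have [i _ Ci] : (\bigcup_i upart (U := U) C i) x by rewrite cUC.
  exists (upart (U := U) C i); split=> //.
  have mC n : measurable (C n i) by have [+ _ _] := pC n; apply.
  have -> : pmp_prob aU (upart (U := U) C i) =
      ulim U (fun n => pmp_prob (r n)) (fun n => C n i).
    exact: ultra_measure_uset.
apply: (@cvge_le _ (ultra_sets U) _ R (fun n => pmp_prob (r n) (C n i))).
    by apply: filterS UC => n; apply.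
  exact: ulim_cvg.
Qed.

Lemma ultraproduct_std_model : exists s : Act G R, weakly_equivalent s aU.
Proof.
have [[N UN]|nU] := pselect (exists N, constant_size N).
  by have [s sP] := finite_model UN; exists (FinAct s).
have [|s sP] := diffuse_model; last by exists (StdAct s).
by move=> N UN; apply: nU; exists N.
Qed.

End model_of_ultraproduct.

(** The representatives [r] are arbitrary, so the identification of the limit does not depend on the
    choice made by [repr]. *)
Theorem theorem2p22 (R : realType) (G : groupType)
    (countableG : countable [set: G])
    (a : nat -> ActBar G R) (r : nat -> Act G R)
    (ra : forall n, wclass (r n) = a n) :
  (forall U : nonprincipal_ultrafilter,
    exists l : ActBar G R,
      [/\ a n @[n --> ultra_sets U] --> l,
          forall l' : ActBar G R, a n @[n --> ultra_sets U] --> l' -> l' = l &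
          class_equivalent l (ultraproduct U (fun n => action_of (r n)))]) /\
  (forall l : ActBar G R,
    a n @[n --> \oo] --> l <->
    forall U : nonprincipal_ultrafilter,
      class_equivalent l (ultraproduct U (fun n => action_of (r n)))).
Proof.
have ulimit (U : nonprincipal_ultrafilter) : exists l : ActBar G R,
    a n @[n --> ultra_sets U] --> l /\
    class_equivalent l (ultraproduct U (fun n => action_of (r n))).
  have [s sU] := ultraproduct_std_model countableG U r.
  exists (wclass s); split; last exact/class_equivalent_wclass.
  apply/cvg_wcP => F k e e0.
  have e20 : 0 < e / 2 by rewrite divr_gt0.
  apply: filterS2 (@dweak_to_ultraproduct G R U (fun n => action_of (r n)) F k _ e20)
    (@dweak_from_ultraproduct G R U (fun n => action_of (r n)) F k _ e20) => n rU Ur.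
  (* As [s] is weakly equivalent to the ultraproduct, each half of [dbar] is at most a distance
     between [r n] and the ultraproduct. *)
  rewrite -ra dbar_wclass [e]splitr addrC ltrD//.
    rewrite (le_lt_trans (dweak_triangle _ _ _
      (ultraproduct U (fun n => action_of (r n))) _))//.
    by rewrite sU.2 addr0.
  rewrite (le_lt_trans (dweak_triangle _ _ _
    (ultraproduct U (fun n => action_of (r n))) _))//.
  by rewrite sU.1 add0r.
split=> [U|l].
  have [l [al lU]] := ulimit U; exists l; split=> // l' al'.
  exact: cvg_wc_unique al' al.
split=> [al U|lU].
  have [l' [al' l'U]] := ulimit U.
  rewrite (_ : l = l')//; apply: cvg_wc_unique _ al'.
  exact: cvg_trans (cvg_app _ (@ultra_cvg U)) al.
(* Without convergence, infinitely many [a n] stay at distance at least [e] from [l], and some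
   nonprincipal ultrafilter contains the set of these [n]. By [lU] the limit along it is [l], a
   contradiction. *)
apply/cvg_wcP => F k e e0; apply: contrapT => nal.
have [U Ual] : exists U : nonprincipal_ultrafilter,
    ultra_sets U [set n | ~ dbar F k l (a n) < e].
  apply: infinite_ultra; apply: contra_not nal.
  by apply: filterS => n /contrapT.
have [l' [/cvg_wcP al' l'U]] := ulimit U.
have ll' : l = l'.
  apply: ActBar_eqP; apply: weakly_equivalent_trans (lU U) _.
  exact: weakly_equivalent_sym.
have [n [/= h]] := filter_ex (filterI Ual (al' F k e e0)).
by rewrite -ll'.
Qed.
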